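(* For each $\varepsilon>0$, with probability 1 there exists $n_0=n_0(\varepsilon)$ such that for all $n\ge n_0$: (i) $(\xi(S_j,\infty),\Xi(S_j,\infty))\in((1+\varepsilon)\log n)\,\mathcal D$ for all $j=1,2,\dots,n$; (ii) for every $(k,\ell)\in((1-\varepsilon)\log n)\,\mathcal D\cap\mathbb Z^2$ there exists a (random) integer $j=j(k,\ell)\le n$ with $(\xi(S_j,\infty),\Xi(S_j,\infty))=(k+1,\ell+2)$.
   Context: Let $0<q<p<1$ with $p+q=1$. Let $X_1,X_2,\dots$ be i.i.d. with $\mathbf P(X_1=1)=p$, $\mathbf P(X_1=-1)=q$, $S_0=0$, $S_n=X_1+\dots+X_n$. For $z\in\mathbb Z$ let $\xi(z,\infty)=\#\{k\ge1:S_k=z\}$ (finite a.s.) and $\Xi(z,\infty)=\xi(z-1,\infty)+\xi(z+1,\infty)$. Define, with the convention $0\log0=0$, $$g(x,y)=x\log x-y\log y+(y-x)\log(y-x)-x\log(2p)-y\log q,$$ and $\mathcal D=\{(x,y)\in\mathbb R^2: y\ge x\ge0,\ g(x,y)\le1\}$. For $c>0$, $c\mathcal D=\{(cx,cy):(x,y)\in\mathcal D\}$.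
   Formalization: The formal theorem assumes ε ≤ 1: for ε > 1 the factor (1−ε) log n is negative, where cD is not defined, and extending the formula makes (ii) false, e.g. (k,ℓ)=(−2,−2) would need ξ=−1; (i) for ε > 1 follows from ε = 1. *)

(* Defs.v *)
From HB Require Import structures.
From mathcomp Require Import all_boot all_order all_algebra.
From mathcomp Require Import all_classical all_reals all_analysis.
Set Implicit Arguments. Unset Strict Implicit. Unset Printing Implicit Defensive.
Import Order.TTheory GRing.Theory Num.Theory.
Local Open Scope classical_set_scope.
Local Open Scope ring_scope.

Section Defs.
Variables (d : measure_display) (T : measurableType d) (R : realType).

Definition mutually_independent (P : probability T R) (X : nat -> T -> R) :=
  forall (s : seq nat) (B : nat -> set R),
    uniq s -> (forall i, measurable (B i)) ->
    P (\bigcap_(i in [set` s]) (X i @^-1` B i)) =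
    (\prod_(i <- s) fine (P (X i @^-1` B i)))%:E.

(* X i is the step X_{i+1}; S X n w = X_1 + ... + X_n, S X 0 w = 0. *)
Definition S (X : nat -> T -> R) (n : nat) (w : T) : R := \sum_(i < n) X i w.

Definition occ (X : nat -> T -> R) (z : R) (w : T) : set nat :=
  [set k | (0 < k)%N /\ S X k w = z].

(* xi_is X z w m  <->  xi(z, oo) (at outcome w) is finite and equal to m *)
Definition xi_is (X : nat -> T -> R) (z : R) (w : T) (m : nat) : Prop :=
  exists s : seq nat, uniq s /\ size s = m /\ (forall k, k \in s <-> occ X z w k).

Definition Xi_is (X : nat -> T -> R) (z : R) (w : T) (m : nat) : Prop :=
  exists a b : nat, xi_is X (z - 1) w a /\ xi_is X (z + 1) w b /\ m = (a + b)%N.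
End Defs.

Section Rate.
Variable R : realType.

Definition xlnx (x : R) : R := if x == 0 then 0 else x * ln x.

Definition g (p q : R) (x y : R) : R :=
  xlnx x - xlnx y + xlnx (y - x) - x * ln (2 * p) - y * ln q.

Definition DD (p q : R) : set (R * R) :=
  [set xy | 0 <= xy.1 <= xy.2 /\ g p q xy.1 xy.2 <= 1].

Definition scaleD (p q c : R) : set (R * R) :=
  [set xy | exists2 u, DD p q u & xy = (c * u.1, c * u.2)].
End Rate.

(* Main.v *)
Require Import Defs.
From HB Require Import structures.
From mathcomp Require Import all_boot all_order all_algebra.
From mathcomp Require Import all_classical all_reals all_analysis.
From mathcomp Require Import ring lra zify.
Set Implicit Arguments. Unset Strict Implicit. Unset Printing Implicit Defensive.
Import Order.TTheory GRing.Theory Num.Theory.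
Local Open Scope classical_set_scope.
Local Open Scope ring_scope.

(* Let [excw a b = (2p)^a q^b C(b,a)], which is [exp (- g a b)] up to a power of
   [b] by Stirling.  A first-step analysis gives the joint law of the future
   numbers of visits to a site and to its two neighbours in closed form; from
   far below it is a constant times [excw a (b-1)].  Hence a site [z] has
   [g > (1+eps) ln z] with probability summable in [z], and Borel-Cantelli
   yields (i).  For (ii), cut the first [n] steps into independent blocks of
   length of order [ln n].  In each block the pair [(k+1,l+2)] is realized at
   some site with probability at least [n^(-1+eps/2)], so that all [n / O(ln n)]
   blocks miss it with summable probability, and a local drawdown bound of order
   [ln n] shows that other blocks do not visit that site or its neighbours. *)

(** * Words of steps and local times *)

(** Total local times depend on the whole infinite path, whereas the estimates concern words of
    finite length. The bridge is that [law] solves the first-step equations exactly: iterating them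
    over [n] steps is an identity between finite sums, and bounds on [law] for a walk well above the
    target turn it into two-sided estimates. So [law] is never identified with the probability that
    motivates it, and on the probability space only upper bounds for finite unions of cylinders are
    used.

    In (i), a union over the sites visited up to time [n] with threshold [ln n] would give about
    [n^(-eps)], which need not be summable. Indexing by the site [z] with threshold [ln z] cures
    this and loses nothing, since a site visited by time [n] is at most [n]. In (ii), independence
    holds only for events read inside one block; aiming at height [H] above the start of the block
    and asking it to end above [2 H] leaves margins larger than the drawdown, so that counts inside
    the block are final. *)

Definition step (b : bool) : int := if b then 1 else -1.

Definition pos (s : seq bool) : int := \sum_(b <- s) step b.

(* As in [occ], the starting point of the word is not counted as a visit. *)
Fixpoint visits (z : int) (s : seq bool) : nat :=
  if s is b :: s' then ((step b == z) + visits (z - step b) s')%N else 0%N.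

Definition nvisits (z : int) (s : seq bool) : nat :=
  (visits (z - 1) s + visits (z + 1) s)%N.

Lemma pos_nil : pos [::] = 0. Proof. exact: big_nil. Qed.

Lemma pos_cons b s : pos (b :: s) = step b + pos s. Proof. exact: big_cons. Qed.

Lemma pos_cat s t : pos (s ++ t) = pos s + pos t. Proof. exact: big_cat. Qed.

Lemma nvisits_cons z b s : nvisits z (b :: s) =
  (((step b == z - 1)%R + (step b == z + 1)%R) + nvisits (z - step b) s)%N.
Proof.
rewrite /nvisits /= (_ : z - 1 - step b = z - step b - 1); last by ring.
rewrite (_ : z + 1 - step b = z - step b + 1); last by ring.
by rewrite addnACA.
Qed.

(** Every visit to [z], and the start if [z = 0], is followed by a step to a neighbour unless the
    word ends there. This yields the inequality [x <= y] in [DD]. *)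
Lemma visits_le_nvisits z s :
  (visits z s + (z == 0)%R <= nvisits z s + (pos s == z)%R)%N.
Proof.
elim: s z => [|b s IH] z; first by rewrite /nvisits pos_nil [0 == z]eq_sym.
have := IH (z - step b); rewrite nvisits_cons pos_cons /=.
have -> : (step b + pos s == z) = (pos s == z - step b) by lia.
by case: b; rewrite /step; lia.
Qed.

Lemma visits_size z s : (visits z s <= size s)%N.
Proof.
elim: s z => //= b s IH z; have := IH (z - step b); lia.
Qed.

Lemma pos_size s : pos s <= (size s)%:Z.
Proof.
by elim: s => [|b s]; rewrite ?pos_nil // pos_cons /=; case: b; rewrite /step; lia.
Qed.

Lemma pos_geNsize s : (- (size s)%:Z <= pos s).
Proof.
by elim: s => [|b s]; rewrite ?pos_nil // pos_cons /=; case: b; rewrite /step; lia.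
Qed.

(** * Expectations over words of independent steps *)

Section Expectation.
Variables (R : realType) (p q : R).

Fixpoint Ex (n : nat) (f : seq bool -> R) : R :=
  if n is m.+1 then p * Ex m (fun s => f (true :: s)) +
                    q * Ex m (fun s => f (false :: s))
  else f [::].

Lemma eq_Ex n f h : (forall s, size s = n -> f s = h s) -> Ex n f = Ex n h.
Proof.
elim: n f h => [|n IH] f h fh /=; first exact: fh.
by congr (_ * _ + _ * _); apply: IH => s sn; apply: fh => /=; rewrite sn.
Qed.

Lemma ExD n f h : Ex n (fun s => f s + h s) = Ex n f + Ex n h.
Proof. by elim: n f h => [|n IH] f h //=; rewrite !IH; ring. Qed.

Lemma ExZ n c f : Ex n (fun s => c * f s) = c * Ex n f.
Proof. by elim: n f => [|n IH] f //=; rewrite !IH; ring. Qed.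

Lemma Ex0 n : Ex n (fun=> 0) = 0.
Proof. by elim: n => [|n IH] //=; rewrite IH !mulr0 addr0. Qed.

Lemma Ex_sum n (I : Type) (r : seq I) (F : I -> seq bool -> R) :
  Ex n (fun s => \sum_(i <- r) F i s) = \sum_(i <- r) Ex n (F i).
Proof.
elim: r => [|i r IH].
  by rewrite big_nil -[RHS](Ex0 n); apply: eq_Ex => s _; rewrite big_nil.
by rewrite big_cons -IH -ExD; apply: eq_Ex => s _; rewrite big_cons.
Qed.

Lemma Ex_cat m n f : Ex (m + n) f = Ex m (fun s => Ex n (fun t => f (s ++ t))).
Proof. by elim: m f => [|m IH] f //=; rewrite !IH. Qed.

Hypotheses (p_ge0 : 0 <= p) (q_ge0 : 0 <= q) (pq1 : p + q = 1).

Lemma Ex_cst n c : Ex n (fun=> c) = c.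
Proof. by elim: n => [|n IH] //=; rewrite IH -mulrDl pq1 mul1r. Qed.

Lemma le_Ex n f h : (forall s, size s = n -> f s <= h s) -> Ex n f <= Ex n h.
Proof.
elim: n f h => [|n IH] f h fh /=; first exact: fh.
by apply: lerD; apply: ler_wpM2l => //; apply: IH => s sn; apply: fh => /=; rewrite sn.
Qed.

(** Disjoint blocks are independent: splitting off the first block leaves a word of [N] blocks and
    one factor [1 - Ex M hit]. *)
Lemma Ex_blocks M N (hit : pred (seq bool)) :
  Ex (N * M) (fun s => (all (fun i => ~~ hit (take M (drop (i * M) s))) (iota 0 N))%:R) =
  (1 - Ex M (fun s => (hit s)%:R)) ^+ N.
Proof.
elim: N => [|N IH]; first by rewrite mul0n.
rewrite mulSn Ex_cat exprS -IH.
rewrite (@eq_Ex M _ (fun s => Ex (N * M) (fun t =>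
    (all (fun i => ~~ hit (take M (drop (i * M) t))) (iota 0 N))%:R) *
    (1 + (-1) * (hit s)%:R))).
  by rewrite ExZ ExD ExZ Ex_cst mulrC mulN1r.
move=> s sM; rewrite mulrC -ExZ; apply: eq_Ex => t _ /=.
rewrite drop0 take_size_cat // -add1n iotaDl all_map.
under eq_all => i do rewrite /= mulSn drop_cat sM ltnNge leq_addr /= addKn.
by case: (hit s) => /=; rewrite ?mul0r ?mulN1r ?subrr ?mul0r // oppr0 addr0 mul1r.
Qed.

End Expectation.

(** * The joint law of the local times *)

Section LocalTimeLaw.
Variables (R : realType) (p q : R).

Definition excw (a b : nat) : R := (2 * p) ^+ a * q ^+ b * 'C(b, a)%:R.

(** The walk stands at the left neighbour, not counted. Drifting to the right it must cross the
    site, so [a = 0] has weight 0. Otherwise the [b] visits split into [a + 1] stretches of which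
    only the first may be empty, whence [C(b, a)]. *)
Definition law_left (a b : nat) : R :=
  if a == 0%N then 0 else p * (p - q) / (2 * q) * excw a b.

(** The walk stands at the right neighbour, from which it escapes with probability [p - q]. Never
    touching the site has weight [(p - q) * q ^ b], twice what the formula for [a > 0] would give at
    [a = 0]. *)
Definition law_right (a b : nat) : R :=
  (p - q) / 2 * excw a b * (if a == 0%N then 2 else 1).

(* [law z a b] is the probability that a walk standing at distance [z] below a
   site will visit that site [a] times and its two neighbours [b] times in all:
   each of the [a] excursions from the site goes to one of two sides, which is
   the factor [2 ^ a], and a neighbour is visited [m] times during an excursion
   with probability [p q ^ m]. *)
Definition law (z : int) (a b : nat) : R :=
  match z with
  | Posz 0 => if b is b'.+1 then p * (p - q) * excw a b' else 0
  | Posz 1 => law_left a b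
  | Posz _ => if b is b'.+1 then law_left a b' else 0
  | Negz 0 => law_right a b
  | Negz m => (1 - (q / p) ^+ m) * ((a == 0%N) && (b == 0%N))%:R
              + (q / p) ^+ m * (if b is b'.+1 then law_right a b' else 0)
  end.

(** The law of the visits still to come when [x] and [y] have been made. It vanishes when these
    exceed the target, where truncated subtraction would give a wrong value. *)
Definition shift (F : nat -> nat -> R) (x y a b : nat) : R :=
  if (x <= a)%N && (y <= b)%N then F (a - x)%N (b - y)%N else 0.

Lemma shift_shift F x y x' y' a b :
  shift (shift F x y) x' y' a b = shift F (x' + x) (y' + y) a b.
Proof.
rewrite /shift; case: ifP => [/andP[xa yb]|].
  by rewrite !leq_subRL // !subnDA.
case: ifP => // /andP[xa yb] /negbT; rewrite negb_and -!ltnNge.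
lia.
Qed.

Lemma excwS a b : excw a b.+1 =
  q * excw a b + if a is a'.+1 then 2 * p * q * excw a' b else 0.
Proof.
rewrite /excw; case: a => [|a]; first by rewrite !bin0 exprS; ring.
by rewrite binS natrD !exprS; ring.
Qed.

Hypotheses (p_gt0 : 0 < p) (q_gt0 : 0 < q) (pq1 : p + q = 1) (qp : q < p).

(** Positions near the site are separate cases because a step may land on it or on a neighbour.
    Farther below the law is constant, farther above only the power of [q / p] changes. *)
Lemma law_step z a b : law z a b =
  p * shift (law (z - 1)) (1 == z) ((1 == z - 1)%R + (1 == z + 1)%R) a b +
  q * shift (law (z + 1)) (-1 == z) ((-1 == z - 1)%R + (-1 == z + 1)%R) a b.
Proof.
have p0 : p != 0 by rewrite gt_eqF.
have q0 : q != 0 by rewrite gt_eqF.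
have pE : p = 1 - q by rewrite -pq1 addrK.
case: z => [[|[|[|z]]]|[|[|z]]]; case: a => [|a]; case: b => [|b]; rewrite /shift /=.
all: rewrite ?(addn0, add0n, subn0, addn1, subSS, subn1) /=.
all: rewrite ?exprS ?expr0.
all: try move: ((q / p) ^+ z) => X.
all: rewrite /law_left /law_right /= ?excwS.
all: try have e00 : excw 0 0 = 1 by rewrite /excw bin0 !expr0 !mul1r.
all: try have ea0 x : excw x.+1 0 = 0 by rewrite /excw bin0n mulr0.
all: rewrite ?e00 ?ea0 ?pE.
all: rewrite pE in p0.
all: by field; rewrite ?p0 ?q0.
Qed.

(** A martingale identity at time [n]: the target is then at relative position [z - pos s] and the
    visits already made are deducted. *)
Lemma law_Ex n z a b : law z a b =
  Ex p q n (fun s => shift (law (z - pos s)) (visits z s) (nvisits z s) a b).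
Proof.
elim: n z a b => [|n IH] z a b /=.
  by rewrite /shift pos_nil /= !subn0 subr0.
have shift_step c : shift (law (z - step c)) (step c == z)
      ((step c == z - 1)%R + (step c == z + 1)%R) a b =
    Ex p q n (fun s => shift (law (z - pos (c :: s)))
      (visits z (c :: s)) (nvisits z (c :: s)) a b).
  transitivity (Ex p q n (fun s => shift (shift (law (z - step c - pos s))
      (visits (z - step c) s) (nvisits (z - step c) s))
      (step c == z) ((step c == z - 1)%R + (step c == z + 1)%R) a b)).
    rewrite {1}/shift; case: ifP => ab.
      by rewrite (IH (z - step c)); apply: eq_Ex => s _; rewrite [in RHS]/shift ab.
    by rewrite -[LHS](Ex0 p q n); apply: eq_Ex => s _; rewrite [in RHS]/shift ab.
  apply: eq_Ex => s _; rewrite shift_shift nvisits_cons pos_cons opprD addrA /=.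
  by [].
by rewrite law_step -(shift_step true) -(shift_step false) /= opprK.
Qed.

Let r_ge0 : 0 <= q / p. Proof. by rewrite divr_ge0 // ltW. Qed.
Let r_lt1 : q / p < 1. Proof. by rewrite ltr_pdivrMr // mul1r. Qed.
Let rX_le1 n : (q / p) ^+ n <= 1. Proof. by rewrite exprn_ile1 // ltW. Qed.

Lemma excw_ge0 a b : 0 <= excw a b.
Proof. by rewrite !mulr_ge0 // exprn_ge0 // ?mulr_ge0 // ltW. Qed.

Lemma excw_le1 a b : excw a b <= 1.
Proof.
move: (p_gt0) (q_gt0) (pq1) (qp) => p0 q0 pqE pq.
elim: b a => [|b IH] a.
  case: a => [|a]; first by rewrite /excw bin0 !expr0 !mul1r.
  by rewrite /excw bin0n mulr0.
rewrite excwS; have := IH a; have := excw_ge0 a b.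
have q1 : q <= 1 by lra.
case: a => [|a]; first by move=> *; rewrite addr0 mulr_ile1 // ltW.
have := IH a; have := excw_ge0 a b.
move: (excw a b) (excw a.+1 b) => x y x0 x1 y0 y1.
apply: (@le_trans _ _ (q + 2 * p * q)); last by nra.
by apply: lerD; [rewrite ger_pMr | rewrite ger_pMr // !mulr_gt0].
Qed.

Let pq_ge0 : 0 <= p - q. Proof. by rewrite subr_ge0 ltW. Qed.

Lemma law_left_ge0 a b : 0 <= law_left a b.
Proof.
rewrite /law_left; case: ifP => // _; apply: mulr_ge0; last exact: excw_ge0.
by rewrite divr_ge0 ?mulr_ge0 // ltW.
Qed.

Lemma law_right_bound a b : 0 <= law_right a b <= 1.
Proof.
move: (p_gt0) (q_gt0) (pq1) (qp) => p0 q0 pqE pq.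
rewrite /law_right; have := excw_ge0 a b; have := excw_le1 a b.
move: (excw a b) => x x1 x0; case: ifP => _; apply/andP; split; nra.
Qed.

Lemma law_ge0 z a b : 0 <= law z a b.
Proof.
case: z => [[|[|z]]|[|m]] /=; rewrite ?law_left_ge0 //.
- case: b => // b; rewrite mulr_ge0 ?excw_ge0 //; apply: mulr_ge0 => //.
  exact: ltW.
- by case: b => // b; exact: law_left_ge0.
- by case/andP: (law_right_bound a b).
- rewrite addr_ge0 // mulr_ge0 ?subr_ge0 ?exprn_ge0 //.
  by case: b => // b; case/andP: (law_right_bound a b).
Qed.

(** The prefactor of [law_left] may exceed 1, and [law] is not shown to be a probability; hence this
    crude uniform bound. *)
Definition law_bound : R := 1 + p * (p - q) / (2 * q).

Let al_ge0 : 0 <= p * (p - q) / (2 * q).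
Proof. by rewrite divr_ge0 ?mulr_ge0 // ltW. Qed.

Lemma law_bound_ge1 : 1 <= law_bound.
Proof. by rewrite /law_bound lerDl. Qed.

Lemma law_le z a b : law z a b <= law_bound.
Proof.
move: (p_gt0) (q_gt0) (pq1) (qp) (al_ge0) => p0 q0 pqE pq al0.
have K1 := law_bound_ge1; have K0 := le_trans ler01 K1.
have left_le x y : law_left x y <= law_bound.
  rewrite /law_left /law_bound; case: ifP => _; first by lra.
  have := excw_le1 x y; move: (excw x y) => e e1.
  by apply: (@le_trans _ _ (p * (p - q) / (2 * q))); [rewrite ler_piMr|rewrite lerDr].
case: z => [[|[|z]]|[|m]] //=.
- case: b => // b; apply: le_trans K1; have := excw_le1 a b; have := excw_ge0 a b.
  by move=> e0 e1; rewrite mulr_ile1 // ?mulr_ge0 //; [exact: ltW|nra].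
- by case: b.
- by case/andP: (law_right_bound a b) => _ h; exact: le_trans h K1.
- apply: le_trans K1; have := rX_le1 m.+1; have := exprn_ge0 m.+1 r_ge0.
  move: (_ ^+ m.+1) => x x0 x1.
  set y := (X in _ + x * X <= _).
  have y1 : y <= 1 by rewrite /y; case: b @y => // b y; case/andP: (law_right_bound a b).
  by case: (_ && _) => /=; nra.
Qed.

(** From this far above, the walk comes back near the site with probability at most [(q / p) ^ H],
    and otherwise makes no further visit. *)
Lemma law_far (H : nat) z a b : (0 < H)%N -> z < - H%:Z ->
  law z a b <= ((a == 0%N) && (b == 0%N))%:R + (q / p) ^+ H.
Proof.
case: z => [z|[|m]] H0 zH; [lia|lia|] => /=.
have Hm : (H <= m.+1)%N by lia.
have := ler_wiXn2l r_ge0 (ltW r_lt1) Hm.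
have := rX_le1 m.+1; have := exprn_ge0 m.+1 r_ge0.
move: (_ ^+ m.+1) (_ ^+ H) => x u x0 x1 xu.
set y := (X in _ + x * X <= _).
have /andP[y0 y1] : 0 <= y <= 1.
  by rewrite /y; case: b @y => [|b] y; [rewrite lexx ler01|exact: law_right_bound].
by case: (_ && _) => /=; nra.
Qed.

(* Once the walk is at least two steps above the target, it never comes back
   near it with probability at least [1 - q / p]. *)
Lemma Ex_visits_le n z a b :
  Ex p q n (fun s => [&& visits z s == a, nvisits z s == b & z + 2 <= pos s]%:R)
    <= law z a b / (1 - q / p).
Proof.
have r1 : 0 < 1 - q / p by rewrite subr_gt0.
rewrite ler_pdivlMr // mulrC -ExZ (law_Ex n); apply: le_Ex; rewrite ?ltW // => s _.
case: and3P => [[/eqP -> /eqP -> zs]|_]; last first.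
  by rewrite mulr0 /shift; case: ifP => // _; exact: law_ge0.
rewrite /shift !leqnn !subnn /= mulr1.
case E: (z - pos s) => [m|[|m]]; [lia|lia|] => /=.
rewrite mulr0 addr0 mulr1 lerB // exprS ler_piMr // ?rX_le1 //.
Qed.

(** In [law_Ex], words ending above [z + H] contribute the event itself up to the error of
    [law_far]; each slower word is charged [law_bound]. *)
Lemma Ex_visits_ge n (H : nat) z a b : (0 < H)%N ->
  law z a b - law_bound * ((q / p) ^+ H
      + Ex p q n (fun s => (pos s <= z + H%:Z)%R%:R))
  <= Ex p q n (fun s => [&& visits z s == a, nvisits z s == b & z + H%:Z < pos s]%:R).
Proof.
move=> H0; have K1 := law_bound_ge1; have K0 := le_trans ler01 K1.
have rH : 0 <= (q / p) ^+ H by exact: exprn_ge0.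
rewrite lerBlDr mulrDr -(Ex_cst pq1 n (law_bound * _)) -ExZ -!ExD (law_Ex n).
apply: le_Ex; rewrite ?ltW // => s _.
case: (lerP (pos s) (z + H%:Z)) => zs; rewrite /= ?andbF ?andbT /=.
  rewrite mulr1 add0r; apply: (@le_trans _ _ law_bound); last by rewrite lerDr mulr_ge0.
  by rewrite /shift; case: ifP => _ //; exact: law_le.
rewrite mulr0 addr0 /shift; case: ifP => [/andP[va nb]|_]; last by rewrite addr_ge0 // mulr_ge0.
have zH : z - pos s < - H%:Z by lia.
apply: le_trans (law_far _ _ H0 zH) _; rewrite !subn_eq0.
have -> : (a <= visits z s)%N = (visits z s == a) by rewrite eqn_leq va.
have -> : (b <= nvisits z s)%N = (nvisits z s == b) by rewrite eqn_leq nb.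
by rewrite lerD2l ler_peMl.
Qed.
End LocalTimeLaw.

(** * The rate function *)

Section Logarithms.
Variable R : realType.
Implicit Types x y c : R.

Lemma ln_le_subr1 x : 0 < x -> ln x <= x - 1.
Proof.
move=> x0; have := @le_ln1Dx R (x - 1); rewrite (_ : 1 + (x - 1) = x); last by ring.
by apply; lra.
Qed.

Lemma ln_ge_subV x : 0 < x -> 1 - x^-1 <= ln x.
Proof.
move=> x0; have := ln_le_subr1 (x := x^-1); rewrite invr_gt0 lnV ?posrE // => /(_ x0); lra.
Qed.

Lemma ln_nat_ge0 n : 0 <= ln n%:R :> R.
Proof. by case: n => [|n]; [rewrite ln0|rewrite ln_ge0 // ler1n]. Qed.

Lemma ln_natS_ge n : (0 < n)%N -> n.+1%:R^-1 <= ln n.+1%:R - ln n%:R :> R.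
Proof.
move=> n0; have n0' : 0 < n%:R :> R by rewrite ltr0n.
have n1' : 0 < n.+1%:R :> R by rewrite ltr0n.
have := @ln_ge_subV (n.+1%:R / n%:R) (divr_gt0 n1' n0').
rewrite ln_div ?posrE // invf_div => h; apply: le_trans h.
rewrite -addn1 natrD in n1' *; rewrite le_eqVlt; apply/orP; left; apply/eqP.
by field; rewrite gt_eqF.
Qed.

Lemma ln_natS_le n : (0 < n)%N -> ln n.+1%:R - ln n%:R <= n%:R^-1 :> R.
Proof.
move=> n0; have n0' : 0 < n%:R :> R by rewrite ltr0n.
have n1' : 0 < n.+1%:R :> R by rewrite ltr0n.
have := @ln_le_subr1 (n.+1%:R / n%:R) (divr_gt0 n1' n0').
rewrite ln_div ?posrE // => h; apply: (le_trans h).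
rewrite -addn1 natrD in n1' *; rewrite le_eqVlt; apply/orP; left; apply/eqP.
by field; rewrite gt_eqF.
Qed.

Lemma xlnx_nat n : xlnx n%:R = n%:R * ln n%:R :> R.
Proof. by rewrite /xlnx; case: eqP => // ->; rewrite mul0r. Qed.

Lemma ln_fact_ge n : xlnx n%:R - n%:R <= ln n`!%:R :> R.
Proof.
rewrite xlnx_nat; elim: n => [|n IH]; first by rewrite fact0 ln1 mul0r subrr.
rewrite factS natrM lnM ?posrE ?ltr0n ?fact_gt0 //.
case: n IH => [_|n IH]; first by rewrite fact0 ln1; lra.
have := ln_natS_le (ltn0Sn n); have n1 : 0 < n.+1%:R :> R by rewrite ltr0n.
rewrite -(ler_pM2l n1) divff ?gt_eqF // mulrBr => h.
rewrite -[n.+2]addn1 natrD mulrDl in h *; lra.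
Qed.

(** A coarse Stirling bound. The coefficient 2 of the logarithm lets the induction close: it needs
    [m / (m + 1) + 2 / (m + 2) >= 1], which fails with 1 in place of 2. *)
Lemma ln_fact_le n : ln n`!%:R <= xlnx n%:R - n%:R + 2 * ln n.+1%:R + 1 :> R.
Proof.
rewrite xlnx_nat; elim: n => [|n IH]; first by rewrite fact0 ln1; lra.
rewrite factS natrM lnM ?posrE ?ltr0n ?fact_gt0 //.
case: n IH => [_|n IH]; first by rewrite fact0 ln1; have := @ln_nat_ge0 2; lra.
have := ln_natS_ge (ltn0Sn n); have := ln_natS_ge (ltn0Sn n.+1).
have n1 : 0 < n.+1%:R :> R by rewrite ltr0n.
have E2 : n.+2%:R = n.+1%:R + 1 :> R by rewrite -[n.+2]addn1 natrD.
have E3 : n.+3%:R = n.+1%:R + 2 :> R by rewrite -[n.+3]addn2 natrD.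
move: (ln n.+1%:R) (ln n.+2%:R) (ln n.+3%:R) IH => l1 l2 l3.
rewrite E2 E3; move: (n.+1%:R) n1 (ln _) => m m0 f IH h2 h1.
suff : m * (m + 1)^-1 + 2 * (m + 2)^-1 - 1 >= 0.
  have : m * (m + 1)^-1 <= m * (l2 - l1) by rewrite ler_pM2l.
  nra.
rewrite (_ : _ - 1 = m / ((m + 1) * (m + 2))); first by rewrite divr_ge0 //; nra.
by field; rewrite !gt_eqF //; lra.
Qed.

Lemma ln_bin k l : (k <= l)%N ->
  ln 'C(l, k)%:R = ln l`!%:R - ln k`!%:R - ln (l - k)`!%:R :> R.
Proof.
move=> kl; have := bin_fact kl => /(congr1 (fun n => ln n%:R : R)).
rewrite !natrM !lnM ?posrE ?mulr_gt0 ?ltr0n ?fact_gt0 ?bin_gt0 // => <-; ring.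
Qed.

Lemma ln_nat_le m n : (0 < m)%N -> (m <= n)%N -> ln m%:R <= ln n%:R :> R.
Proof. by move=> m0 mn; rewrite ler_ln ?posrE ?ltr0n ?ler_nat // (leq_trans m0). Qed.

(** The tangent bound [ln t <= t - 1] at [t = c / x]. Its right side is linear, so two instances
    whose weights add up to [y] cancel in [g_ge]. *)
Lemma xlnx_young x c : 0 <= x -> 0 < c -> x * ln c - xlnx x <= c - x.
Proof.
move=> x0 c0; rewrite /xlnx; case: eqP => [->|/eqP xn0].
  by rewrite mul0r !subr0 ltW.
have {xn0}x0 : 0 < x by rewrite lt_neqAle eq_sym xn0.
have := @ln_le_subr1 (c / x) (divr_gt0 c0 x0).
rewrite -(ler_pM2l x0) ln_div ?posrE // !mulrBr mulr1 mulrCA divff ?gt_eqF // mulr1; lra.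
Qed.
End Logarithms.

Section RateFunction.
Variables (R : realType) (p q : R).
Hypotheses (p_gt0 : 0 < p) (q_gt0 : 0 < q) (pq1 : p + q = 1) (qp : q < p).

(** Summing [excw a b] over [a] gives [(q (1 + 2 p)) ^ b], so this is the decay rate in [b]. It is
    positive because [1 - q (1 + 2 p) = p (p - q)]. *)
Definition grate : R := - ln (q * (1 + 2 * p)).

Lemma grate_gt0 : 0 < grate.
Proof.
move: (p_gt0) (q_gt0) (pq1) (qp) => p0 q0 pqE pq.
rewrite oppr_gt0 ln_lt0 // mulr_gt0 //=; nra.
Qed.

(* Gibbs' inequality with the weights [2 p / (1 + 2 p)] and [1 / (1 + 2 p)]. *)
Lemma g_ge (x y : R) : 0 <= x <= y -> grate * y <= g p q x y.
Proof.
move: (p_gt0) (q_gt0) (pq1) (qp) => p0 q0 pqE pq /andP[x0 xy].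
have y0 : 0 <= y := le_trans x0 xy; have w0 : 0 < 1 + 2 * p by lra.
rewrite /g /grate lnM ?posrE //; have [y0'|yn0] := eqVneq y 0.
  by rewrite (_ : x = 0) ?y0' ?subrr /xlnx ?eqxx; lra.
have {yn0}y0 : 0 < y by rewrite lt_neqAle eq_sym yn0.
have c20 : 0 < y / (1 + 2 * p) by exact: divr_gt0.
have c10 : 0 < 2 * p * (y / (1 + 2 * p)) by rewrite !mulr_gt0 // invr_gt0.
have := @xlnx_young R x (2 * p * (y / (1 + 2 * p))) x0 c10.
have := @xlnx_young R (y - x) (y / (1 + 2 * p)); rewrite subr_ge0 => /(_ xy c20).
have p20 : 0 < 2 * p by rewrite mulr_gt0.
rewrite (@lnM _ (2 * p) (y / (1 + 2 * p))) ?posrE // ln_div ?posrE //.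
have -> : xlnx y = y * ln y by rewrite /xlnx gt_eqF.
have -> : 2 * p * (y / (1 + 2 * p)) = y - y / (1 + 2 * p) by field; rewrite gt_eqF.
lra.
Qed.

Lemma g_scale (c x y : R) : 0 < c -> 0 <= x <= y -> g p q (c * x) (c * y) = c * g p q x y.
Proof.
move=> c0 /andP[x0 xy]; have y0 := le_trans x0 xy.
have xlnxM t : 0 <= t -> xlnx (c * t) = c * xlnx t + c * t * ln c.
  move=> t0; rewrite /xlnx mulf_eq0 gt_eqF //=; case: eqP => [->|/eqP tn0].
    by rewrite !mulr0 mul0r addr0.
  have {tn0}t0 : 0 < t by rewrite lt_neqAle eq_sym tn0.
  by rewrite lnM ?posrE //; ring.
rewrite /g -mulrBr !xlnxM ?subr_ge0 //; ring.
Qed.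

Lemma g00 : g p q 0 0 = 0.
Proof.
have x0 : xlnx (0 : R) = 0 by rewrite /xlnx eqxx.
by rewrite /g !subrr x0 !mul0r !subr0 addr0.
Qed.

Lemma scaleDP (c x y : R) : 0 <= c ->
  scaleD p q c (x, y) -> 0 <= x <= y /\ g p q x y <= c.
Proof.
(* The case [c = 0] occurs for [eps = 1]; the scaled set is then the origin. *)
rewrite le_eqVlt => /orP[/eqP <-|c0] [[u v] [/= uv guv] [-> ->]].
  by rewrite !mul0r g00 !lexx.
case/andP: (uv) => u0 v0; rewrite mulr_ge0 ?(ltW c0) // ler_pM2l // v0 g_scale //.
by rewrite ger_pMr.
Qed.

Lemma scaleD_intro (c x y : R) : 0 < c -> 0 <= x <= y -> g p q x y <= c ->
  scaleD p q c (x, y).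
Proof.
move=> c0 /andP[x0 xy] gc; have c0' : c != 0 by rewrite gt_eqF.
exists (x / c, y / c) => /=; last by rewrite ![c * _]mulrC !divfK.
have V : 0 < c^-1 by rewrite invr_gt0.
rewrite /DD /= divr_ge0 ?(ltW c0) //= ler_pM2r // xy; split=> //.
by rewrite ![_ / c]mulrC g_scale // ?x0 // mulrC ler_pdivrMr // mul1r.
Qed.

Lemma excwE a b : (a <= b)%N ->
  excw p q a b = expR (a%:R * ln (2 * p) + b%:R * ln q + ln 'C(b, a)%:R).
Proof.
move=> ab; rewrite !expRD !expRM_natl !lnK // posrE ?mulr_gt0 //.
by rewrite ltr0n bin_gt0.
Qed.

(** The linear terms of the three Stirling bounds cancel and only logarithms remain: from one
    factorial here, from two in the lower bound. *)
Lemma excw_le a b : (a <= b)%N ->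
  excw p q a b <= expR (- g p q a%:R b%:R + 2 * ln b.+1%:R + 1).
Proof.
move=> ab; rewrite excwE // ler_expR ln_bin // /g -natrB //.
have := ln_fact_le R b; have := ln_fact_ge R a; have := ln_fact_ge R (b - a).
by rewrite natrB //; lra.
Qed.

Lemma excw_ge a b : (a <= b)%N ->
  expR (- g p q a%:R b%:R - 4 * ln b.+1%:R - 2) <= excw p q a b.
Proof.
move=> ab; rewrite excwE // ler_expR ln_bin // /g -natrB //.
have := ln_fact_ge R b; have := ln_fact_le R a; have := ln_fact_le R (b - a).
have ba : (b - a <= b)%N by rewrite leq_subr.
have := @ln_nat_le R a.+1 b.+1 (ltn0Sn _) ab.
have := @ln_nat_le R (b - a).+1 b.+1 (ltn0Sn _) ba.
by rewrite natrB //; lra.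
Qed.
End RateFunction.

(** * Concentration estimates *)

Section Asymptotics.
Variable R : realType.

Lemma affine_le_exp (a b d : R) : 0 < d ->
  exists x0 : R, forall x, x0 <= x -> a + b * x <= expR (d * x).
Proof.
move=> d0; pose K := `|a| + `|b|; have d20 : 0 < d ^+ 2 by rewrite exprn_gt0.
exists (1 + 2 * K / d ^+ 2) => x x0.
have K0 : 0 <= K by rewrite addr_ge0.
have x1 : 1 <= x by apply: le_trans x0; rewrite lerDl divr_ge0 // ?mulr_ge0 // ltW.
have dx0 : 0 <= d * x by rewrite mulr_ge0 ?(ltW d0) //; lra.
have := expR_ge1Dxn 1 dx0; rewrite exprMn (_ : 2`!%:R = 2 :> R) //; apply: le_trans.
have dx : 2 * K <= d ^+ 2 * x.
  rewrite [leRHS]mulrC -ler_pdivrMr //; lra.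
have aK : a <= `|a| by exact: ler_norm.
have bK : b <= `|b| by exact: ler_norm.
have bx : b * x <= `|b| * x by rewrite ler_pM2r //; lra.
have ax : `|a| <= `|a| * x by rewrite ler_peMr.
have : K * x <= d ^+ 2 * x ^+ 2 / 2.
  by rewrite ler_pdivlMr // expr2 mulrA mulrAC [K * 2]mulrC ler_pM2r //; lra.
rewrite /K mulrDl; lra.
Qed.

Lemma ln_le_affine (e x : R) : 0 < e -> 0 < x -> ln x <= e * x - 1 - ln e.
Proof.
move=> e0 x0; have := @ln_le_subr1 R (e * x) (mulr_gt0 e0 x0).
by rewrite lnM ?posrE //; lra.
Qed.

Lemma sum_geometric_le (k : R) n : 0 < k ->
  \sum_(0 <= i < n) expR (- k * i%:R) <= (1 - expR (- k))^-1.
Proof.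
move=> k0; have w1 : 0 < 1 - expR (- k) by rewrite subr_gt0 expR_lt1 oppr_lt0.
rewrite -(ler_pM2l w1) divff ?gt_eqF //.
rewrite (eq_bigr (fun i => expR (- k) ^+ i)) => [|i _]; last by rewrite expRM_natr.
by rewrite big_mkord -opprB mulNr -subrX1 opprB lerBlDr lerDl exprn_ge0 // expR_ge0.
Qed.

Lemma sum_riemann_le (d : R) n : 0 < d ->
  \sum_(1 <= i < n) expR (- (1 + d) * ln i%:R) <= 1 + d^-1.
Proof.
move=> d0; have V0 : 0 < d^-1 by rewrite invr_gt0.
(* Comparison with the integral: the induction carries the remainder [(m + 1)^(-d) / d]. *)
suff H m : \sum_(1 <= i < m.+2) expR (- (1 + d) * ln i%:R)
           <= 1 + d^-1 * (1 - expR (- d * ln m.+1%:R)).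
  case: n => [|[|m]]; first by rewrite big_geq //; lra.
    by rewrite big_geq //; lra.
  by apply: le_trans (H m) _; rewrite lerD2l ler_piMr ?(ltW V0) // gerBl expR_ge0.
elim: m => [|m IH].
  by rewrite big_nat1 ln1 !mulr0 expR0 subrr mulr0 addr0.
rewrite big_nat_recr //=; apply: le_trans (lerD IH (lexx _)) _.
rewrite -addrA lerD2l -lerBrDl -mulrBr.
rewrite -(ler_pM2l d0) mulrA divff ?gt_eqF // mul1r.
set l1 := ln m.+1%:R; set l2 := ln m.+2%:R.
have E : expR (- l2) = m.+2%:R^-1 :> R by rewrite expRN lnK // posrE ltr0n.
have := @ln_natS_ge R m.+1 (ltn0Sn _); rewrite -/l1 -/l2 -E => h.
have := expR_ge1Dx (d * (l2 - l1)).
rewrite (_ : - d * l1 = - d * l2 + d * (l2 - l1)); last by ring.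
rewrite (_ : - (1 + d) * l2 = - d * l2 + - l2); last by ring.
rewrite !expRD => h2.
have e0 := expR_gt0 (- d * l2).
have : d * expR (- l2) <= expR (d * (l2 - l1)) - 1 by nra.
by move=> /(ler_wpM2l (ltW e0)); lra.
Qed.
End Asymptotics.

(** * Linear speed of the walk, and sums over pairs of local times *)

Section Estimates.
Variables (R : realType) (p q : R).
Hypotheses (p_gt0 : 0 < p) (q_gt0 : 0 < q) (pq1 : p + q = 1) (qp : q < p).
Local Notation Ex := (Ex p q).

Let p_ge0 := ltW p_gt0.
Let q_ge0 := ltW q_gt0.

Lemma Ex_drop n j (f : seq bool -> R) : (j <= n)%N ->
  Ex n (fun s => f (drop j s)) = Ex (n - j) f.
Proof.
move=> jn; rewrite -{1}(subnKC jn) Ex_cat -[RHS](Ex_cst pq1 j).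
by apply: eq_Ex => s sj; apply: eq_Ex => t _; rewrite drop_size_cat.
Qed.

Lemma Ex_has_le n (I : Type) (r : seq I) (A : I -> pred (seq bool)) :
  Ex n (fun s => (has (A^~ s) r)%:R) <= \sum_(i <- r) Ex n (fun s => (A i s)%:R).
Proof.
rewrite -Ex_sum; apply: le_Ex => // s _.
elim: r => [|i r IH] /=; first by rewrite big_nil.
rewrite big_cons; case: (A i s) => /=; last by rewrite add0r.
by rewrite lerDl sumr_ge0.
Qed.

Lemma Ex_le1 n (A : pred (seq bool)) : Ex n (fun s => (A s)%:R) <= 1.
Proof.
by rewrite -[leRHS](Ex_cst pq1 n); apply: le_Ex => // s _; case: (A s).
Qed.

Lemma Ex_expR_pos n (c : R) :
  Ex n (fun s => expR (c * (pos s)%:~R)) = (p * expR c + q * expR (- c)) ^+ n.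
Proof.
elim: n => [|n IH] /=; first by rewrite pos_nil mulr0 expR0.
have st b : Ex n (fun s => expR (c * (pos (b :: s))%:~R)) =
    expR (c * (step b)%:~R) * (p * expR c + q * expR (- c)) ^+ n.
  rewrite -IH -ExZ; apply: eq_Ex => s _.
  by rewrite pos_cons intrD mulrDr expRD.
by rewrite !st /= mulr1 mulrN1 exprS; ring.
Qed.

Lemma walk_chernoff : exists2 c : R, 0 < c & exists2 mu : R, 0 < mu &
  forall n, Ex n (fun s => ((pos s)%:~R <= c * n%:R)%R%:R) <= expR (- mu * n%:R).
Proof.
move: (p_gt0) (q_gt0) (pq1) (qp) => p0 q0 pqE pq.
(* Exponential tilt with [expR la = 1 / (2 q)]: the one-step transform is then [2 p q + 1/2], below
   1 because [4 p q < 1]. *)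
have q20 : 0 < 2 * q by lra.
have la0 : 0 < - ln (2 * q) by rewrite oppr_gt0 ln_lt0 // q20; lra.
have ph0 : 0 < 2 * p * q + 2^-1 by rewrite addr_gt0 ?invr_gt0 // !mulr_gt0.
have mu0 : 0 < - ln (2 * p * q + 2^-1) by rewrite oppr_gt0 ln_lt0 // ph0 /=; nra.
move Ela : (- ln (2 * q)) la0 => la la0; move Emu : (- ln _) mu0 => mu mu0.
have eE : p * expR (- la) + q * expR (- (- la)) = expR (- mu).
  rewrite opprK -Ela -Emu !opprK expRN !lnK ?posrE //; field.
  by rewrite gt_eqF.
(* At this slope Markov's inequality spends half of the exponent. *)
exists (mu / (2 * la)); first by rewrite divr_gt0 // mulr_gt0.
exists (mu / 2) => [|n]; first by rewrite divr_gt0.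
apply: (@le_trans _ _ (Ex n (fun s => expR (mu / 2 * n%:R) * expR (- la * (pos s)%:~R)))).
  apply: le_Ex => // s _; case: (lerP _ (_ * n%:R)) => h /=; last by rewrite mulr_ge0 ?expR_ge0.
  rewrite -expRD -[leLHS]expR0 ler_expR.
  rewrite mulrAC ler_pdivlMr ?mulr_gt0 // in h; lra.
rewrite ExZ Ex_expR_pos eE -expRM_natr -expRD ler_expR; lra.
Qed.

(** With [C = 3 / mu], each suffix of length at least [C ln m] is slow with probability at most
    [m^-3], and there are at most [m] of them. Shorter suffixes can lose only [O(ln m)] in height
    anyway. *)
Lemma Ex_slow_suffix : exists2 c : R, 0 < c & exists2 C : R, 0 < C &
  forall m, (0 < m)%N ->
  Ex m (fun s => (has (fun j => (C * ln m%:R <= (m - j)%:R) &&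
       ((pos (drop j s))%:~R <= c * (m - j)%:R)) (iota 0 m))%:R)
    <= expR (- (1 + 1) * ln m%:R).
Proof.
have [c c0 [mu mu0 H]] := walk_chernoff; exists c => //; exists (3 / mu) => [|m m0].
  by rewrite divr_gt0.
apply: le_trans (Ex_has_le _ _ (fun j s => _)) _.
apply: (@le_trans _ _ (\sum_(j <- iota 0 m) expR (- 3 * ln m%:R))).
  rewrite !big_seq; apply: ler_sum => j; rewrite mem_iota add0n => /andP[_ jm].
  case: (boolP (3 / mu * ln m%:R <= _)) => [h|_] /=; last first.
    by rewrite (@eq_Ex _ p q m _ (fun=> 0)) // Ex0 expR_ge0.
  rewrite (@Ex_drop m j (fun s => ((pos s)%:~R <= c * (m - j)%:R)%R%:R)) ?(ltnW jm) //.
  apply: le_trans (H _) _; rewrite ler_expR.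
  rewrite mulrAC ler_pdivrMr // in h; lra.
rewrite big_const_seq count_predT size_iota iter_addr_0 -[leLHS]mulr_natr.
have mE : m%:R = expR (ln m%:R) :> R by rewrite lnK // posrE ltr0n.
rewrite [X in expR _ * X]mE -expRD ler_expR; lra.
Qed.

(** A word of length [n] makes at most [n] visits to a site and [2 n] to its neighbours, so the
    pairs below [N] exhaust the event. *)
Lemma Ex_visits_sum_le n N (z : int) (A : nat -> nat -> bool) :
  (n.*2 < N)%N ->
  Ex n (fun s => (A (visits z s) (nvisits z s) && (z + 2 <= pos s))%:R) <=
  \sum_(0 <= a < N) \sum_(0 <= b < N) (A a b)%:R * (law p q z a b / (1 - q / p)).
Proof.
move=> nN; apply: (@le_trans _ _ (\sum_(0 <= a < N) \sum_(0 <= b < N) (A a b)%:R *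
    Ex n (fun s => [&& visits z s == a, nvisits z s == b & z + 2 <= pos s]%:R))).
  under eq_bigr => a _ do (under eq_bigr => b _ do rewrite -ExZ; rewrite -Ex_sum).
  rewrite -Ex_sum; apply: le_Ex => // s sn.
  have va := visits_size z s.
  have nb : (nvisits z s <= n.*2)%N.
    by rewrite -addnn leq_add // -sn visits_size.
  have vN : (visits z s < N)%N by lia.
  have F0 a b : 0 <= (A a b)%:R * [&& visits z s == a, nvisits z s == b & z + 2 <= pos s]%:R :> R.
    by rewrite mulr_ge0.
  rewrite !big_mkord (bigD1 (Ordinal vN)) //=.
  rewrite !big_mkord (bigD1 (Ordinal (leq_ltn_trans nb nN))) //= !eqxx /= -natrM mulnb.
  by rewrite -addrA lerDl addr_ge0 ?sumr_ge0 // => i _; rewrite sumr_ge0.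
apply: ler_sum => a _; apply: ler_sum => b _; apply: ler_wpM2l => //.
exact: Ex_visits_le.
Qed.
End Estimates.

(** * Atypical sites and unrealized pairs *)

Section Bounds.
Variables (R : realType) (p q : R).
Hypotheses (p_gt0 : 0 < p) (q_gt0 : 0 < q) (pq1 : p + q = 1) (qp : q < p).
Local Notation Ex := (Ex p q).
Local Notation g := (g p q).

Let p_ge0 := ltW p_gt0.
Let q_ge0 := ltW q_gt0.
Let al : R := p * (p - q) / (2 * q).

Let al_gt0 : 0 < al.
Proof. by rewrite divr_gt0 ?mulr_gt0 // subr_gt0. Qed.

Lemma law_below z a b : (2 <= z)%N ->
  law p q z a b = if b is b'.+1 then law_left p q a b' else 0.
Proof. by case: z => [|[|z]]. Qed.

Lemma law_below_le z a b : (2 <= z)%N -> law p q z a b <= al / q * excw p q a b.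
Proof.
move=> z2; rewrite law_below //.
have K0 : 0 <= al / q by rewrite ltW // divr_gt0.
have e0 x y := excw_ge0 p_gt0 q_gt0 x y.
case: b => [|b]; first by rewrite mulr_ge0.
rewrite /law_left; case: ifP => _; first by rewrite mulr_ge0.
rewrite -/al -[al / q * _]mulrA ler_pM2l // ler_pdivlMl //  excwS lerDl.
by case: a => // a; rewrite mulr_ge0 // !mulr_ge0.
Qed.

Lemma Ex_atypical_le (eps : R) : 0 < eps -> exists2 C : R, 0 < C &
  forall (z n : nat), (2 <= z)%N ->
  Ex n (fun s => (((1 + eps) * ln z%:R < g (visits z s)%:R (nvisits z s)%:R) &&
                  (z%:Z + 2 <= pos s))%:R)
  <= C * expR (- (1 + eps / 2) * ln z%:R).
Proof.
move=> eps0; have c0 := grate_gt0 p_gt0 q_gt0 pq1 qp.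
move: (p_gt0) (q_gt0) (qp) => p0 q0 pq.
(* Here [(1 - d) (1 + eps) = 1 + eps / 2]. The share [1 - d] of [g] pays for the power of [z]; the
   share [d], at least [4 k b] by [g_ge], pays for the polynomial factor in [b] and for geometric
   sums in [a] and [b]. *)
pose d : R := (eps / 2) / (1 + eps).
have d0 : 0 < d by rewrite divr_gt0 //; lra.
have dE : d * (1 + eps) = eps / 2 by rewrite divfK // gt_eqF //; lra.
pose k : R := d * grate p q / 4.
have k0 : 0 < k by rewrite divr_gt0 // mulr_gt0.
pose K2 : R := 2 * k - 2 - 2 * ln k + 1.
have r1 : 0 < 1 - q / p by rewrite subr_gt0 ltr_pdivrMr // mul1r.
pose K3 : R := al / q / (1 - q / p) * expR K2.
have alq0 : 0 < al / q := divr_gt0 al_gt0 q0.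
have K30 : 0 < K3 := mulr_gt0 (divr_gt0 alq0 r1) (expR_gt0 _).
pose G := (1 - expR (- k))^-1.
have G0 : 0 < G by rewrite invr_gt0 subr_gt0 expR_lt1 oppr_lt0.
exists (K3 * G * G) => [|z n z2]; first exact: mulr_gt0 (mulr_gt0 K30 G0) G0.
set x := ln z%:R; set E := expR (- (1 + eps / 2) * x).
have E0 : 0 <= E by exact: expR_ge0.
have term a b : ((1 + eps) * x < g a%:R b%:R)%R%:R * (law p q z a b / (1 - q / p))
    <= K3 * E * expR (- k * a%:R) * expR (- k * b%:R).
  case: (ltrP _ (g _ _)) => [gx|_]; last first.
    rewrite mul0r; do 2 apply: mulr_ge0 (expR_ge0 _).
    by apply: mulr_ge0 E0; exact: ltW.
  rewrite mul1r ler_pdivrMr //; apply: le_trans (law_below_le _ _ z2) _.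
  case: (leqP a b) => ab; last first.
    rewrite /excw bin_small // !mulr0; apply: mulr_ge0 (ltW r1).
    by apply: mulr_ge0 (expR_ge0 _); apply: mulr_ge0 (expR_ge0 _); apply: mulr_ge0 E0; exact: ltW.
  apply: (@le_trans _ _ (al / q * expR (K2 - (1 + eps / 2) * x - k * a%:R - k * b%:R))).
    rewrite ler_pM2l //; apply: le_trans (excw_le p_gt0 q_gt0 ab) _.
    rewrite ler_expR.
    have ab' : a%:R <= b%:R :> R by rewrite ler_nat.
    have := @g_ge _ _ _ p_gt0 q_gt0 pq1 qp a%:R b%:R; rewrite ler0n ab' => /(_ isT) gb.
    have b1 : 0 < b.+1%:R :> R by rewrite ltr0n.
    have := ln_le_affine k0 b1; rewrite -[b.+1]addn1 natrD => lb.
    have d1 : 0 < 1 - d by rewrite subr_gt0 ltr_pdivrMr; lra.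
    have g1 : (1 + eps / 2) * x <= (1 - d) * g a%:R b%:R.
      rewrite (_ : 1 + eps / 2 = (1 - d) * (1 + eps)); last by rewrite mulrBl dE; lra.
      by rewrite -mulrA ler_pM2l // ltW.
    have g2 : 4 * k * b%:R <= d * g a%:R b%:R.
      by rewrite (_ : 4 * k * b%:R = d * (grate p q * b%:R)) ?ler_pM2l // /k; field.
    have kab : k * a%:R <= k * b%:R by rewrite ler_pM2l.
    rewrite /K2; lra.
  rewrite le_eqVlt; apply/orP; left; apply/eqP; rewrite /K3 /E.
  rewrite !mulNr !expRD; field; rewrite !gt_eqF //; lra.
apply: le_trans (Ex_visits_sum_le p_gt0 q_gt0 pq1 qp _
  (fun a b => (1 + eps) * x < g a%:R b%:R) (ltnSn _)) _.
apply: le_trans (ler_sum _ (fun a _ => ler_sum _ (fun b _ => term a b))) _.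
under eq_bigr => a _ do rewrite -mulr_sumr mulrAC.
rewrite -mulr_sumr (_ : K3 * G * G * E = K3 * E * G * G); last by ring.
have S0 := sum_geometric_le n.*2.+1 k0.
have Sge0 : 0 <= \sum_(0 <= i < n.*2.+1) expR (- k * i%:R).
  by rewrite sumr_ge0 // => i _; exact: expR_ge0.
have KE : 0 <= K3 * E := mulr_ge0 (ltW K30) E0.
rewrite -[leLHS]mulrA -[leRHS]mulrA; apply: (ler_wpM2l KE).
exact: ler_pM.
Qed.

(** Positions are relative to the start of a block. The height [H] separates the target from the
    past of the block, the end above [2 H] from its future. *)
Definition hit (H k l : nat) : pred (seq bool) := fun s =>
  [&& visits H s == k.+1, nvisits H s == l.+2 & H%:Z + H%:Z < pos s].

Lemma Ex_hit_ge : exists2 K : R, 0 < K & forall H M k l, (2 <= H)%N -> (k <= l)%N ->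
  K * expR (- g k%:R l%:R - 4 * ln l.+1%:R) -
    law_bound p q * ((q / p) ^+ H + Ex M (fun s => (pos s <= H%:Z + H%:Z)%R%:R))
  <= Ex M (fun s => (hit H k l s)%:R).
Proof.
exists (al * (2 * p * q) * expR (- 2)) => [|H M k l H2 kl].
  by apply: mulr_gt0 (expR_gt0 _); apply: (mulr_gt0 al_gt0); rewrite !mulr_gt0.
apply: le_trans (Ex_visits_ge p_gt0 q_gt0 pq1 qp M H k.+1 l.+2 (ltnW H2)).
rewrite lerD2r law_below //= /law_left /= -/al; set X := expR (- g _ _ - _).
rewrite (_ : al * _ * _ * X = al * (2 * p * q * (expR (- 2) * X))); last by ring.
(* Pascal's rule keeps the term [2 p q excw k l] of [excw k.+1 l.+1]. This and the first arrival at
   the left neighbour account for the shift to [(k + 1, l + 2)]. *)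
rewrite ler_pM2l // excwS.
have e0 x y := excw_ge0 p_gt0 q_gt0 x y.
apply: le_trans (_ : 2 * p * q * excw p q k l <= _); last by rewrite /= lerDr mulr_ge0.
rewrite ler_pM2l ?mulr_gt0 // -expRD; apply: le_trans (excw_ge p_gt0 q_gt0 kl).
rewrite ler_expR; lra.
Qed.

Definition miss (x : R) (H M N B : nat) : pred (seq bool) := fun s =>
  has (fun kl => [&& (kl.1 <= kl.2)%N, g kl.1%:R kl.2%:R <= x &
                     all (fun i => ~~ hit H kl.1 kl.2 (take M (drop (i * M) s))) (iota 0 N)])
      [seq (k, l) | k <- iota 0 B, l <- iota 0 B].

Lemma Ex_miss_le_aux (x P0 : R) (H M N B : nat) : 0 <= P0 -> 
  (forall k l, (k <= l)%N -> g k%:R l%:R <= x -> P0 <= Ex M (fun s => (hit H k l s)%:R)) ->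
  Ex (N * M) (fun s => (miss x H M N B s)%:R) <= (B * B)%:R * expR (- P0 * N%:R).
Proof.
move=> P00 hP; apply: le_trans (Ex_has_le p_gt0 q_gt0 _ _ _) _.
apply: (@le_trans _ _ (\sum_(kl <- [seq (k, l) | k <- iota 0 B, l <- iota 0 B])
    expR (- P0 * N%:R))).
  apply: ler_sum => -[k l] _ /=.
  case: (boolP (k <= l)%N) => kl /=; last by rewrite (@eq_Ex _ p q _ _ (fun=> 0)) // Ex0 expR_ge0.
  case: (boolP (g _ _ <= x)) => gx /=; last by rewrite (@eq_Ex _ p q _ _ (fun=> 0)) // Ex0 expR_ge0.
  rewrite (Ex_blocks pq1) expRM_natr.
  have := hP _ _ kl gx; set h := Ex _ _ => Ph.
  have h1 : h <= 1 by exact: Ex_le1.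
  apply: lerXn2r; rewrite ?nnegrE ?expR_ge0 ?subr_ge0 //.
  by apply: le_trans (expR_ge1Dx _); rewrite lerD2l lerN2.
rewrite big_const_seq count_predT size_allpairs !size_iota iter_addr_0.
by rewrite -[leLHS]mulr_natl.
Qed.

Lemma truncnS_bounds (y : R) : 0 <= y -> y <= (Num.truncn y).+1%:R <= y + 1.
Proof.
move=> y0; have /andP[h1 h2] := truncn_itv y0.
by rewrite (ltW h2) -addn1 natrD lerD2r.
Qed.

Definition level (C : R) (n : nat) : nat := (Num.truncn (C * ln n%:R)).+1.

(** By [g_ge], pairs with [g <= ln n] have both coordinates below this value. *)
Definition max_Xi (n : nat) : nat := (Num.truncn (ln n%:R / grate p q)).+1.

Definition miss_upto (eps C : R) (D n : nat) : pred (seq bool) :=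
  let M := (D * level C n)%N in
  miss ((1 - eps) * ln n%:R) (level C n) M (n %/ M) (max_Xi n).

End Bounds.

Lemma exponent_le (R : realType) (a C x h : R) :
  0 <= a -> 0 <= x -> 2 <= a * C -> C * x <= h -> x + x <= a * h.
Proof.
move=> a0 x0 aC Cx; have h1 : a * (C * x) <= a * h by rewrite ler_wpM2l.
have h2 : 2 * x <= a * C * x by rewrite ler_wpM2r.
lra.
Qed.

Lemma Ex_slow_block (R : realType) (p q c mu : R) (D H M : nat) :
  0 < p -> 0 < q -> 0 < mu -> (0 < D)%N -> 2 <= D%:R * c ->
  M = (D * H)%N ->
  (forall n, Ex p q n (fun s => ((pos s)%:~R <= c * n%:R)%R%:R) <= expR (- mu * n%:R)) ->
  Ex p q M (fun s => (pos s <= H%:Z + H%:Z)%R%:R) <= expR (- (mu * H%:R)).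
Proof.
move=> p_gt0 q_gt0 mu0 D0 Dc -> chern.
apply: le_trans (_ : _ <= Ex p q (D * H) (fun s => ((pos s)%:~R <= c * (D * H)%:R)%R%:R)) _.
  apply: le_Ex; [exact: ltW|exact: ltW|move=> s _].
  case: (lerP (pos s) _) => // ps; rewrite ler1n lt0b.
  have : (pos s)%:~R <= (H%:Z + H%:Z)%:~R :> R by rewrite ler_int.
  rewrite intrD -!pmulrn natrM => h; apply: (le_trans h).
  rewrite (_ : H%:R + H%:R = 2 * H%:R); last by ring.
  by rewrite mulrA ler_wpM2r // mulrC.
apply: le_trans (chern _) _; rewrite ler_expR mulNr lerN2 ler_pM2l // ler_nat.
by rewrite leq_pmull.
Qed.

Lemma Ex_hit_typical (R : realType) (p q : R)
  (p_gt0 : 0 < p) (q_gt0 : 0 < q) (pq1 : p + q = 1) (qp : q < p)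
  (eps C1 : R) : 0 < eps <= 1 ->
  exists2 K : R, 0 < K & exists2 C : R, C1 <= C /\ 0 < C & exists2 D : nat, (0 < D)%N &
  forall (n k l : nat), let x : R := ln n%:R in
  1 <= C * x -> (k <= l)%N -> g p q k%:R l%:R <= (1 - eps) * x ->
  (K * expR (- (1 - 3 / 4 * eps) * x) - law_bound p q * (2 * (expR (- x) * expR (- x)))
  <= Ex p q (D * level C n) (fun s => (hit (level C n) k l s)%:R))%R.
Proof.
case/andP=> eps0 eps1; have gr0 := grate_gt0 p_gt0 q_gt0 pq1 qp.
have [K K0 hitP] := Ex_hit_ge p_gt0 q_gt0 pq1 qp.
have [c c0 [mu mu0 chern]] := walk_chernoff p_gt0 q_gt0 pq1 qp.
have r0 : 0 < q / p by rewrite divr_gt0.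
pose rho : R := - ln (q / p).
have rho0 : 0 < rho by rewrite oppr_gt0 ln_lt0 // r0 ltr_pdivrMr // mul1r.
(* The last two terms make both errors of [Ex_hit_ge] at most [n^-2]; the first leaves room for the
   drawdown bound. *)
pose C : R := `|C1| + 2 / rho + 2 / mu.
have rho20 : 0 < 2 / rho by exact: divr_gt0.
have mu20 : 0 < 2 / mu by exact: divr_gt0.
have C1a : 0 <= `|C1| by [].
have C0 : 0 < C by rewrite /C; lra.
have C1C : C1 <= C by have := ler_norm C1; rewrite /C; lra.
have Crho : 2 <= rho * C by rewrite [leRHS]mulrC -ler_pdivrMr // /C; lra.
have Cmu : 2 <= mu * C by rewrite [leRHS]mulrC -ler_pdivrMr // /C; lra.
have /andP[D1 _] := truncnS_bounds (ltW (divr_gt0 (ltr0n R 2) c0)).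
set D := (Num.truncn (2 / c)).+1 in D1; rewrite ler_pdivrMr // in D1.
(* With this slope, [4 ln (l + 1)] costs at most [eps / 4 * ln n] up to the constant [K5]. *)
pose e : R := eps * grate p q / 16; have e0 : 0 < e by rewrite divr_gt0 // mulr_gt0.
pose K5 : R := 4 * (e - 1 - ln e).
exists (K * expR (- K5)); first by rewrite mulr_gt0 ?expR_gt0.
exists C => //; exists D => // n k l x Cx1 kl gx.
have x0 : 0 <= x by exact: ln_nat_ge0.
have Cx0 : 0 <= C * x by rewrite mulr_ge0 // ltW.
have /andP[H1 _] : C * x <= (level C n)%:R <= C * x + 1 := truncnS_bounds Cx0.
have Hge2 : (2 <= level C n)%N by rewrite ltnS truncn_gt0.
apply: le_trans (hitP _ _ _ _ Hge2 kl); apply: lerB.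
  have kl' : k%:R <= l%:R :> R by rewrite ler_nat.
  have := @g_ge _ _ _ p_gt0 q_gt0 pq1 qp k%:R l%:R; rewrite ler0n kl' => /(_ isT) gl.
  have l0 : 0 < l.+1%:R :> R by rewrite ltr0n.
  rewrite -mulrA ler_pM2l // -expRD ler_expR.
  have := ln_le_affine e0 l0; rewrite -[l.+1]addn1 natrD /K5.
  have : 4 * (e * l%:R) <= eps / 4 * x.
    rewrite (_ : 4 * (e * l%:R) = eps / 4 * (grate p q * l%:R)); last by rewrite /e; field.
    rewrite ler_pM2l ?divr_gt0 //; apply: le_trans gl _; apply: le_trans gx _.
    by rewrite ler_piMl // gerBl ltW.
  move: gx; clear; move: (g _ _ _ _) (ln _) (ln e) => *; lra.
apply: ler_wpM2l; first exact: le_trans ler01 (law_bound_ge1 p_gt0 q_gt0 qp).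
rewrite mulr2n mulrDl mul1r -expRD; apply: lerD.
  rewrite -[q / p](@lnK R) ?posrE // -expRM_natr ler_expR -opprD lerNr -mulNr.
  exact: exponent_le (ltW rho0) x0 Crho H1.
apply: le_trans (Ex_slow_block p_gt0 q_gt0 mu0 (ltn0Sn _) D1 erefl chern) _.
by rewrite ler_expR -opprD lerN2; exact: exponent_le (ltW mu0) x0 Cmu H1.
Qed.

(** A block of length [O(ln n)] is eventually at most [n^(eps/4) / 2]; the factor 2 absorbs the
    rounding of the quotient. *)
Lemma block_count_ge (R : realType) (x eps CC : R) (n D H : nat) :
  n%:R = expR x -> (0 < D * H)%N -> H%:R <= CC * x + 1 -> 0 <= (1 - eps / 4) * x ->
  2 * D%:R + 2 * D%:R * CC * x <= expR (eps / 4 * x) ->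
  expR ((1 - eps / 4) * x) <= (n %/ (D * H))%:R.
Proof.
move=> nE M0 H2 x0 X2; set N := (n %/ _)%N; set W := expR _.
have MR0 : 0 < (D * H)%:R :> R by rewrite ltr0n.
have W1 : 1 <= W by rewrite -expR0 ler_expR.
have nM : n%:R < (N%:R + 1) * (D * H)%:R :> R.
  by rewrite natr1 -natrM ltr_nat ltn_ceil.
have nEW : n%:R = W * expR (eps / 4 * x) by rewrite nE -expRD; congr expR; lra.
have M2 : 2 * (D * H)%:R <= expR (eps / 4 * x).
  apply: le_trans X2; rewrite natrM.
  have : D%:R * H%:R <= D%:R * (CC * x + 1) by rewrite ler_wpM2l.
  clear; lra.
have : W * (2 * (D * H)%:R) < (N%:R + 1) * (D * H)%:R.
  by apply: le_lt_trans nM; rewrite nEW ler_pM2l // expR_gt0.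
by rewrite mulrA ltr_pM2r //; move: W1; clear; lra.
Qed.

Lemma Ex_miss_le (R : realType) (p q : R)
  (p_gt0 : 0 < p) (q_gt0 : 0 < q) (pq1 : p + q = 1) (qp : q < p)
  (eps C1 : R) : 0 < eps <= 1 ->
  exists2 C : R, C1 <= C /\ 0 < C & exists2 D : nat, (0 < D)%N &
  exists n0 : nat, forall n, (n0 <= n)%N ->
  Ex p q (n %/ (D * level C n) * (D * level C n)) (fun s => (miss_upto p q eps C D n s)%:R)
    <= expR (- (1 + 1) * ln n%:R).
Proof.
move=> eps01; have [K K0 [C C0 [D D0 hitP]]] := Ex_hit_typical p_gt0 q_gt0 pq1 qp C1 eps01.
exists C => //; exists D => //.
move: C0 eps01 => [_ C0] /andP[eps0 eps1]; have gr0 := grate_gt0 p_gt0 q_gt0 pq1 qp.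
have L0 := le_trans ler01 (law_bound_ge1 p_gt0 q_gt0 qp).
set L := law_bound p q in hitP L0.
have e40 : 0 < eps / 4 by rewrite divr_gt0.
have e20 : 0 < eps / 2 by rewrite divr_gt0.
(* In terms of [x = ln n]: [x1] keeps the error below half of the hit probability, [x2] gives enough
   blocks, [x3] makes [P0 * N] at least [4 x], and [x4] gives [B <= n]. *)
have [x1 X1] := affine_le_exp (4 * L / K) 0 (@ltr01 R).
have [x2 X2] := affine_le_exp (2 * D%:R) (2 * D%:R * C) e40.
have [x3 X3] := affine_le_exp 0 (8 / K) e20.
have [x4 X4] := affine_le_exp 1 (1 / grate p q) (@ltr01 R).
pose x0 : R := Num.max (Num.max (Num.max x1 x2) (Num.max x3 x4)) (Num.max C^-1 0).
exists (Num.truncn (expR x0)).+1 => n nn; rewrite /miss_upto.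
set x := ln n%:R; set H := level C n; set N := (n %/ _)%N; set B := max_Xi p q n.
have /ltW nx0 : expR x0 < n%:R :> R by rewrite -truncn_lt_nat ?expR_ge0.
have n0 : (0 : R) < n%:R := lt_le_trans (expR_gt0 _) nx0.
have nE : n%:R = expR x by rewrite lnK.
have : x0 <= x by rewrite -ler_expR -nE.
rewrite !ge_max -!andbA => /and5P[/X1{}X1 /X2{}X2 /X3{}X3 /X4{}X4 /andP[xC xge0]].
have {}X1 : 4 * L <= K * expR x.
  by rewrite mul0r addr0 mul1r ler_pdivrMr // [leRHS]mulrC in X1.
have {}X3 : 4 * x <= K / 2 * expR (eps / 2 * x).
  move: X3; rewrite add0r mulrAC ler_pdivrMr // [_ * K]mulrC; clear; lra.
rewrite mul1r in X4.
have Cx1 : 1 <= C * x by rewrite mulrC -ler_pdivrMr // mul1r.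
have /andP[_ H2] : C * x <= H%:R <= C * x + 1 := truncnS_bounds (le_trans ler01 Cx1).
set P0 := K / 2 * expR (- (1 - 3 / 4 * eps) * x).
have P0ge0 : 0 <= P0 by rewrite mulr_ge0 ?expR_ge0 // divr_ge0 // ltW.
have hP k l : (k <= l)%N -> g p q k%:R l%:R <= (1 - eps) * x ->
    P0 <= Ex p q (D * H) (fun s => (hit H k l s)%:R).
  move=> kl gx; apply: le_trans (hitP _ _ _ Cx1 kl gx).
  have E1 : K * expR (- x) <= K * expR (- (1 - 3 / 4 * eps) * x).
    rewrite ler_pM2l // ler_expR; have : 0 <= eps * x by rewrite mulr_ge0 // ltW.
    clear; lra.
  have : 4 * L * (expR (- x) * expR (- x)) <= K * expR (- x).
    have -> : K * expR (- x) = K * expR x * (expR (- x) * expR (- x)).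
      by rewrite -!mulrA; congr (_ * _); rewrite mulrA expRxMexpNx_1 mul1r.
    by rewrite ler_pM2r // mulr_gt0 // expR_gt0.
  move: E1; rewrite /P0 -/x; clear; lra.
apply: le_trans (Ex_miss_le_aux p_gt0 q_gt0 pq1 N B P0ge0 hP) _.
have e4x : 0 <= (1 - eps / 4) * x by rewrite mulr_ge0 //; move: eps1; clear; lra.
have NW : expR ((1 - eps / 4) * x) <= N%:R by apply: block_count_ge H2 _ X2; rewrite ?muln_gt0 ?D0.
have PN : 4 * x <= P0 * N%:R.
  apply: le_trans (_ : P0 * expR ((1 - eps / 4) * x) <= _); last by rewrite ler_wpM2l.
  rewrite /P0 -mulrA -expRD; apply: (le_trans X3).
  rewrite ler_pM2l ?divr_gt0 // ler_expR; clear; lra.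
have BE : B%:R <= expR x.
  have /andP[_ h] := truncnS_bounds (divr_ge0 xge0 (ltW gr0)).
  by apply: (le_trans h); rewrite mul1r in X4; rewrite addrC [x / _]mulrC.
(* At most [n^2] pairs, each missed with probability at most [n^-4]. *)
rewrite natrM; apply: (@le_trans _ _ (expR x * expR x * expR (- (4 * x)))).
  apply: ler_pM; rewrite ?mulr_ge0 ?expR_ge0 //; first by apply: ler_pM.
  by rewrite ler_expR mulNr lerN2.
by rewrite -!expRD ler_expR; clear; lra.
Qed.

(** * From words to the probability space *)

Fixpoint words (n : nat) : seq (seq bool) :=
  if n is m.+1 then map (cons true) (words m) ++ map (cons false) (words m)
  else [:: [::]].

Lemma mem_words s : s \in words (size s).
Proof.
elim: s => [|b s IH] //=; rewrite mem_cat.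
by case: b; rewrite map_f ?orbT.
Qed.

Section Probability.
Variables (d : measure_display) (T : measurableType d) (R : realType).
Variables (P : probability T R) (X : nat -> T -> R) (p q : R).
Hypothesis pq1 : p + q = 1.
Hypothesis X_meas : forall i, measurable_fun setT (X i).
Hypothesis X_indep : mutually_independent P X.
Hypothesis X_1 : forall i, P [set w | X i w = 1] = p%:E.
Hypothesis X_m1 : forall i, P [set w | X i w = -1] = q%:E.

Definition weight (s : seq bool) : R := \prod_(b <- s) (if b then p else q).

Lemma Ex_words n (f : seq bool -> R) : Ex p q n f = \sum_(s <- words n) weight s * f s.
Proof.
elim: n f => [|n IH] f /=; first by rewrite big_seq1 /weight big_nil mul1r.
rewrite big_cat !big_map !IH !mulr_sumr.
by congr (_ + _); apply: eq_bigr => s _; rewrite /weight big_cons mulrA.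
Qed.

Definition sign (b : bool) : R := if b then 1 else -1.

Definition cylinder (s : seq bool) : set T :=
  \bigcap_(i in [set` iota 0 (size s)]) (X i @^-1` [set sign (nth false s i)]).

Lemma measurable_step i x : measurable (X i @^-1` [set x]).
Proof. by rewrite -[X in measurable X]setTI; apply: X_meas => //; exact: measurable_set1. Qed.

Lemma measurable_cylinder s : measurable (cylinder s).
Proof. by apply: fin_bigcap_measurable => // i _; exact: measurable_step. Qed.

Lemma P_cylinder s : P (cylinder s) = (weight s)%:E.
Proof.
rewrite /cylinder (X_indep (B := fun i => [set sign (nth false s i)])) ?iota_uniq //.
  congr EFin; rewrite /weight (big_nth false) /index_iota subn0.
  apply: eq_bigr => i _; rewrite /sign; case: nth => /=.
    by rewrite (X_1 i : P (X i @^-1` [set 1]) = _).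
  by rewrite (X_m1 i : P (X i @^-1` [set -1]) = _).
Qed.

Definition word_event n (A : pred (seq bool)) : set T :=
  \big[setU/set0]_(s <- words n | A s) cylinder s.

Lemma measurable_word_event n A : measurable (word_event n A).
Proof. by apply: bigsetU_measurable => s _; exact: measurable_cylinder. Qed.

Lemma P_word_event n A : (P (word_event n A) <= (Ex p q n (fun s => (A s)%:R))%:E)%E.
Proof.
rewrite Ex_words /word_event; elim: (words n) => [|s r IH].
  by rewrite !big_nil measure0.
rewrite !big_cons; case: (A s); last by rewrite mulr0 add0r.
rewrite mulr1 EFinD; have mr : measurable (\big[setU/set0]_(t <- r | A t) cylinder t).
  by apply: bigsetU_measurable => t _; exact: measurable_cylinder.
apply: le_trans (measureU2 P (measurable_cylinder s) mr) _.
by apply: leeD IH; have <- := P_cylinder s.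
Qed.

Definition bits (w : T) (i : nat) : bool := X i w == 1.

Definition prefix_word (w : T) (n : nat) : seq bool := mkseq (bits w) n.

Lemma word_eventP n (A : pred (seq bool)) w : (forall i, X i w = sign (bits w i)) ->
  A (prefix_word w n) -> word_event n A w.
Proof.
move=> Xs Aw; rewrite /word_event -bigcup_seq_cond.
exists (prefix_word w n) => /=; first by rewrite -{2}(size_mkseq (bits w) n) mem_words.
by move=> i /=; rewrite mem_iota size_mkseq => /= ni; rewrite nth_mkseq.
Qed.

Lemma ae_sign : {ae P, forall w, forall i, X i w = sign (bits w i)}.
Proof.
apply: ae_foralln => i; rewrite /almost_everywhere.
pose A := X i @^-1` [set 1] `|` X i @^-1` [set -1].
have mA : measurable A by apply: measurableU; exact: measurable_step.
exists (~` A); split; first exact: measurableC.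
  have PA : P A = 1%E.
    rewrite /A measureU; [|exact: measurable_step|exact: measurable_step|].
      transitivity (p%:E + q%:E)%E; last by rewrite -EFinD pq1.
      by congr (_ + _)%E; [exact: X_1|exact: X_m1].
    by rewrite -subset0 => w [/= -> h]; lra.
  by have := probability_setC P mA; rewrite PA subee.
move=> w /= Xw [h|h]; apply: Xw; rewrite /bits /sign h ?eqxx //.
by case: eqP => // h'; rewrite h'.
Qed.

Lemma ae_eventually_not (A : nat -> pred (seq bool)) (L : nat -> nat) (C e : R) (n0 : nat) :
  0 < C -> 0 < e ->
  (forall n, (n0 <= n)%N -> Ex p q (L n) (fun s => (A n s)%:R) <= C * expR (- (1 + e) * ln n%:R)) ->
  {ae P, forall w, exists m, forall n, (m <= n)%N -> ~~ A n (prefix_word w (L n))}.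
Proof.
move=> C0 e0 H.
(* Index 0 is dropped: [ln 0 = 0] by convention, and the comparison series starts at 1. *)
pose F n := if (n0 <= n)%N && (0 < n)%N then word_event (L n) (A n) else set0.
have mF n : measurable (F n).
  by rewrite /F; case: ifP => // _; exact: measurable_word_event.
have PF n : (P (F n) <= (if (0 < n)%N then C * expR (- (1 + e) * ln n%:R) else 0)%:E)%E.
  rewrite /F; case: (posnP n) => [->|n1]; first by rewrite andbF measure0.
  case: ifP => [/andP[/H h _]|_]; last by rewrite measure0 lee_fin mulr_ge0 ?expR_ge0 // ltW.
  by apply: le_trans (P_word_event _ _) _; rewrite lee_fin.
have sumF : (\sum_(n <oo) P (F n) < +oo)%E.
  apply: (@le_lt_trans _ _ (C * (1 + e^-1))%:E); last exact: ltry.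
  apply: lime_le; first by apply: is_cvg_nneseries.
  apply: nearW => n; apply: (@le_trans _ _ (\sum_(0 <= i < n)
     (if (0 < i)%N then C * expR (- (1 + e) * ln i%:R) else 0)%:E)%E).
    by apply: lee_sum.
  rewrite sumEFin lee_fin; case: n => [|n].
    by rewrite big_geq // mulr_ge0 ?addr_ge0 ?invr_ge0 // ltW.
  rewrite big_ltn //= add0r.
  rewrite (eq_big_nat _ _ (F2 := fun i => C * expR (- (1 + e) * ln i%:R))); last first.
    by move=> i /andP[-> _].
  by rewrite -mulr_sumr ler_pM2l // sum_riemann_le.
have lim0 := lim_sup_set_cvg0 mF sumF.
have ae0 : {ae P, forall w, ~ lim_sup_set F w}.
  exists (lim_sup_set F); split => //.
    by apply: bigcap_measurable => // k _; apply: bigcup_measurable.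
  by move=> w /=; apply: contrapT.
apply: filterS2 ae0 ae_sign => w nF Xs.
have [n hn] : exists n, forall j, (n <= j)%N -> ~ F j w.
  apply: contrapT => h; apply: nF => n _; apply: contrapT => h2; apply: h.
  by exists n => j nj Fj; apply: h2; exists j.
exists (maxn n (maxn n0 1)) => m; rewrite !geq_max => /and3P[nm n0m m1].
apply/negP => Am; apply: (hn m nm); rewrite /F n0m m1 /=.
exact: word_eventP.
Qed.
End Probability.

(** * Trajectories *)

Lemma visits_count z s :
  visits z s = count (fun k => pos (take k s) == z) (iota 1 (size s)).
Proof.
elim: s z => [|b s IH] z //=; rewrite take0 pos_cons pos_nil addr0 IH.
congr (_ + _)%N; rewrite -[2%N]add1n iotaDl count_map; apply: eq_count => k /=.
by rewrite pos_cons add0n; lia.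
Qed.

Lemma visits_cat z s t : visits z (s ++ t) = (visits z s + visits (z - pos s) t)%N.
Proof.
elim: s z => [|b s IH] z /=; first by rewrite pos_nil subr0.
by rewrite IH addnA pos_cons opprD addrA.
Qed.

Lemma nvisits_cat z s t : nvisits z (s ++ t) = (nvisits z s + nvisits (z - pos s) t)%N.
Proof.
rewrite /nvisits !visits_cat addnACA; congr (_ + (visits _ _ + visits _ _))%N; lia.
Qed.

(** * Deterministic consequences of linear speed *)

Section BitSequence.
Variable b : nat -> bool.

Definition walk (n : nat) : int := pos (mkseq b n).

Lemma take_mkseq j n : (j <= n)%N -> take j (mkseq b n) = mkseq b j.
Proof. by move=> jn; rewrite /mkseq -map_take take_iota (minn_idPl jn). Qed.

Lemma pos_drop_mkseq j n : (j <= n)%N -> pos (drop j (mkseq b n)) = walk n - walk j.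
Proof.
move=> jn; rewrite /walk -{2}(cat_take_drop j (mkseq b n)) pos_cat take_mkseq //.
by rewrite addrC addKr.
Qed.

Lemma walk_lip j n : (j <= n)%N -> walk j - (n - j)%:Z <= walk n.
Proof.
move=> jn; have := pos_geNsize (drop j (mkseq b n)).
rewrite pos_drop_mkseq // size_drop size_mkseq; lia.
Qed.

Lemma walk_le n : walk n <= n%:Z.
Proof. by have := pos_size (mkseq b n); rewrite size_mkseq. Qed.

Lemma walk0 : walk 0 = 0. Proof. exact: pos_nil. Qed.

Lemma visits_walk z n : visits z (mkseq b n) = count (fun k => walk k == z) (iota 1 n).
Proof.
rewrite visits_count size_mkseq; apply: eq_in_count => k; rewrite mem_iota => kn.
by rewrite take_mkseq //; lia.
Qed.

Lemma visits_eq0 z n : (forall k, (k <= n)%N -> walk k != z) -> visits z (mkseq b n) = 0%N.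
Proof.
move=> h; rewrite visits_walk; apply/eqP; rewrite -leqn0 leqNgt -has_count.
by apply/hasPn => k; rewrite mem_iota => kn; apply: h; lia.
Qed.

Lemma visits_gt0 z n : (0 < visits z (mkseq b n))%N -> exists2 k, (k <= n)%N & walk k = z.
Proof.
rewrite visits_walk -has_count => /hasP[k]; rewrite mem_iota => kn /eqP kz.
by exists k => //; lia.
Qed.

Variables (R : realType) (c C : R) (m0 : nat).
Hypotheses (c_gt0 : 0 < c) (C_gt0 : 0 < C).
Hypothesis fast : forall m j, (m0 <= m)%N -> (j < m)%N ->
  C * ln m%:R <= (m - j)%:R -> c * (m - j)%:R < (walk m - walk j)%:~R.

Lemma ln_le_of_leq i n : (i <= n)%N -> ln i%:R <= ln n%:R :> R.
Proof.
case: i => [|i] i_n; first by rewrite ln0 // ln_nat_ge0.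
exact: ln_nat_le.
Qed.

(** Before [m0] and over short intervals, unit steps bound the loss; over long intervals [fast]
    excludes any. *)
Lemma drawdown j m : (j <= m)%N ->
  (walk j)%:~R - C * ln m%:R - m0%:R <= (walk m)%:~R :> R.
Proof.
move=> jm; have L0 : 0 <= C * ln m%:R by rewrite mulr_ge0 ?ln_nat_ge0 // ltW.
have lip : (walk j)%:~R - (m - j)%:R <= (walk m)%:~R :> R.
  by have := walk_lip jm; rewrite -(ler_int R) intrD rmorphN.
have m00 : 0 <= m0%:R :> R by [].
case: (leqP m0 m) => mm; last first.
  have : (m - j)%:R <= m0%:R :> R by rewrite ler_nat; lia.
  lra.
move: jm; rewrite leq_eqVlt => /orP[/eqP ->|jm]; first by lra.
case: (lerP (C * ln m%:R) (m - j)%:R) => h; last by lra.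
have := fast mm jm h; rewrite intrD rmorphN => h2.
have : 0 <= c * (m - j)%:R by rewrite mulr_ge0 // ltW.
lra.
Qed.

Lemma ln_nat_large (G : R) : exists n0 : nat, forall n, (n0 <= n)%N -> G <= ln n%:R.
Proof.
exists (Num.truncn (expR G)).+1 => n.
rewrite truncn_lt_nat ?expR_ge0 // => /ltW h.
by rewrite -ler_expR lnK // posrE (lt_le_trans _ h) // expR_gt0.
Qed.

Lemma ln_nat_le_linear (K : R) : exists n0 : nat, forall n, (n0 <= n)%N -> K * ln n%:R <= n%:R.
Proof.
have [x0 X0] := affine_le_exp 0 K (@ltr01 R).
have [n0 N0] := ln_nat_large x0; exists n0.+1 => n nn.
have := X0 _ (N0 n (ltnW nn)); rewrite add0r mul1r lnK // posrE ltr0n.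
exact: leq_ltn_trans nn.
Qed.

Lemma walk_speed : exists m1 : nat, forall m, (m1 <= m)%N -> c * m%:R < (walk m)%:~R.
Proof.
have [n0 N0] := ln_nat_le_linear C; exists (maxn 1 (maxn m0 n0)) => m.
rewrite !geq_max => /and3P[m1 mm0 mn0].
have := fast mm0 m1; rewrite subn0 walk0 subr0; apply; exact: N0.
Qed.

Lemma walk_leaves z : exists L : nat, forall m, (L <= m)%N -> z + 2 <= walk m.
Proof.
have [m1 M1] := walk_speed; exists (maxn m1 (Num.truncn (`|z|%:R / c + 2 / c)).+1) => m.
rewrite geq_max => /andP[/M1 h1]; rewrite truncn_lt_nat; last first.
  by rewrite addr_ge0 // divr_ge0 // ltW.
rewrite -mulrDl ltr_pdivrMr // mulrC => h2.
have : (`|z| + 2)%:R < (walk m)%:~R :> R by rewrite natrD; apply: lt_trans h1.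
rewrite pmulrn ltr_int; lia.
Qed.

(** All later times must be covered in terms of [ln n]. Up to [n^2] the logarithm at most doubles;
    beyond, [m - j >= m / 2] is long enough for [fast]. *)
Lemma drawdown_far : exists n0 : nat, forall n, (n0 <= n)%N ->
  forall j m, (j <= n)%N -> (j <= m)%N ->
  (walk j)%:~R - 2 * C * ln n%:R - m0%:R <= (walk m)%:~R :> R.
Proof.
have [n0 N0] := ln_nat_le_linear (2 * C).
exists (maxn 2 (maxn m0 n0)) => n; rewrite !geq_max => /and3P[n2 nm0 nn0] j m jn jm.
have L0 : 0 <= C * ln n%:R by rewrite mulr_ge0 ?ln_nat_ge0 // ltW.
have m00 : 0 <= m0%:R :> R by [].
case: (leqP m (n * n)) => mn.
  have := drawdown jm; have : C * ln m%:R <= C * (2 * ln n%:R).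
    rewrite ler_pM2l //; apply: le_trans (ln_le_of_leq mn) _.
    by rewrite natrM lnM ?posrE ?ltr0n; [lra|lia|lia].
  lra.
have nm : (n <= m)%N by nia.
have jm' : (j < m)%N by nia.
have h : C * ln m%:R <= (m - j)%:R.
  have := N0 m (leq_trans nn0 nm); have : m%:R <= 2 * (m - j)%:R :> R.
    by rewrite -natrM ler_nat; nia.
  lra.
have := fast (leq_trans nm0 nm) jm' h; rewrite intrD rmorphN => h2.
have : 0 <= c * (m - j)%:R by rewrite mulr_ge0 // ltW.
lra.
Qed.
End BitSequence.

Lemma neq_near_of_gap (x z : int) :
  x + 2 <= z -> [/\ x != z, x != z - 1 & x != z + 1].
Proof. by move=> h; split; lia. Qed.

Lemma below_before (R : realFieldType) (C L H m wu wj a : R) :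
  wu - a - m <= wj -> a <= C * L -> 0 <= C * L -> (2 * C + 1) * L <= H ->
  m + 2 <= L -> wu + 2 <= wj + H.
Proof. lra. Qed.

(** The source of [2 C + 1]: the later drawdown takes [2 C ln n], and the extra [ln n] covers
    [m0 + 2]. *)
Lemma above_after (R : realFieldType) (C L H m wu wj we : R) :
  we - 2 * C * L - m <= wu -> H + H <= we - wj -> (2 * C + 1) * L <= H ->
  m + 2 <= L -> wj + H + 2 <= wu.
Proof. lra. Qed.

Lemma double_le_int (R : realType) (c K k : R) (z : nat) (x : int) : (2 <= z)%N ->
  2 <= c * K -> c * (K * z%:R) <= c * k -> c * k < x%:~R -> z%:Z + 2 <= x.
Proof.
move=> z2 cK h1 h2; have : 2 * z%:R <= c * K * z%:R by rewrite ler_wpM2r.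
move=> h3; have : (2 * z)%:R < x%:~R :> R by rewrite natrM; lra.
by rewrite pmulrn ltr_int; lia.
Qed.

Section Trajectory.
Variables (d : measure_display) (T : measurableType d) (R : realType).
Variables (X : nat -> T -> R) (w : T).
Hypothesis X_sign : forall i, X i w = sign R (bits X w i).
Let b := bits X w.

Lemma S_walk n : S X n w = (walk b n)%:~R.
Proof.
rewrite /S; elim: n => [|n IH]; first by rewrite big_ord0 walk0.
rewrite big_ord_recr /= IH /walk mkseqS /pos -cats1 big_cat /= big_seq1 intrD.
by congr (_ + _); rewrite X_sign /sign /step /b; case: bits.
Qed.

Lemma xi_is_visits z L : (forall k, (L < k)%N -> walk b k != z) ->
  xi_is X z%:~R w (visits z (mkseq b L)).
Proof.
move=> late; exists [seq k <- iota 1 L | walk b k == z].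
split; first by rewrite filter_uniq // iota_uniq.
split; first by rewrite size_filter visits_walk.
move=> k; rewrite mem_filter mem_iota /occ /= S_walk; split.
  by case/and3P => /eqP -> k0 _; split=> //; lia.
case=> k0 /eqP; rewrite eqr_int => kz; rewrite kz /=.
case: (leqP k L) => kL; first by apply/andP; split; lia.
by move: (late k kL); rewrite kz.
Qed.

Lemma local_times z L : (forall k, (L < k)%N -> z + 2 <= walk b k) ->
  xi_is X z%:~R w (visits z (mkseq b L)) /\ Xi_is X z%:~R w (nvisits z (mkseq b L)).
Proof.
move=> late; split; first by apply: xi_is_visits => k /late; lia.
exists (visits (z - 1) (mkseq b L)), (visits (z + 1) (mkseq b L)).
have zm : z%:~R - 1 = (z - 1)%:~R :> R by rewrite intrD rmorphN.
have zp : z%:~R + 1 = (z + 1)%:~R :> R by rewrite intrD.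
by rewrite zm zp; split; [|split=> //]; apply: xi_is_visits => k /late; lia.
Qed.

Lemma visits_le_nvisits_walk z L : z + 2 <= walk b L ->
  (visits z (mkseq b L) <= nvisits z (mkseq b L))%N.
Proof.
move=> h; have := visits_le_nvisits z (mkseq b L); rewrite -/(walk b L).
have -> : (walk b L == z) = false by lia.
lia.
Qed.

Variables (p q c C : R) (m0 : nat).
Hypotheses (c_gt0 : 0 < c) (C_gt0 : 0 < C).
Hypothesis fast : forall m j, (m0 <= m)%N -> (j < m)%N ->
  C * ln m%:R <= (m - j)%:R -> c * (m - j)%:R < (walk b m - walk b j)%:~R.

(** From time [K * z] on the walk stays above [2 z], so a word of that length already contains all
    visits; then [z <= j <= n] turns the threshold [ln z] into [ln n]. *)
Lemma typical_sites (eps : R) (K z0 : nat) : 0 < eps -> 2 <= c * K%:R ->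
  (forall z : nat, (z0 <= z)%N ->
     ~~ (((1 + eps) * ln z%:R < g p q (visits z (mkseq b (K * z)))%:R
                                      (nvisits z (mkseq b (K * z)))%:R) &&
         (z%:Z + 2 <= walk b (K * z)))) ->
  exists n0 : nat, forall n, (n0 <= n)%N -> forall j, (j <= n)%N ->
    exists a' b' : nat, xi_is X (S X j w) w a' /\ Xi_is X (S X j w) w b' /\
      scaleD p q ((1 + eps) * ln n%:R) (a'%:R, b'%:R).
Proof.
move=> eps0 cK typ; have [m1 M1] := walk_speed fast.
have K1 : (0 < K)%N by case: K cK {typ} => //; rewrite mulr0; lra.
pose z1 := maxn (maxn z0 m1) 2.
pose J := (maxn m1 (Num.truncn (z1%:R / c)).+1).
have early j : (J <= j)%N -> z1%:Z <= walk b j.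
  rewrite geq_max => /andP[/M1 h1]; rewrite truncn_lt_nat; last first.
    by rewrite divr_ge0 // ltW.
  rewrite ltr_pdivrMr // mulrC => h2.
  by have := lt_trans h2 h1; rewrite pmulrn ltr_int => /ltW.
(* The finitely many times before [J] have finite local times, which the growing set absorbs. *)
have [G HG] : exists G : R, forall j, (j < J)%N -> exists a' b' : nat,
    xi_is X (S X j w) w a' /\ Xi_is X (S X j w) w b' /\ (a' <= b')%N /\
    g p q a'%:R b'%:R <= G.
  elim: J {early} => [|J [G HG]]; first by exists 0.
  have [L HL] := walk_leaves c_gt0 C_gt0 fast (walk b J).
  pose a' := visits (walk b J) (mkseq b L); pose b' := nvisits (walk b J) (mkseq b L).
  exists (Num.max G (g p q a'%:R b'%:R)) => j; rewrite ltnS leq_eqVlt => /orP[/eqP ->|/HG].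
    have [h1 h2] := @local_times (walk b J) L (fun k kL => HL k (ltnW kL)).
    exists a', b'; rewrite S_walk; do 2 split=> //; split; last by rewrite le_max lexx orbT.
    exact: visits_le_nvisits_walk (HL L (leqnn _)).
  case=> x [y [h1 [h2 [h3 h4]]]]; exists x, y; do 3 split=> //.
  by rewrite le_max h4.
have [n0 N0] := ln_nat_large (Num.max 1 G).
exists n0 => n /N0; rewrite ge_max => /andP[n1 nG] j jn.
have cpos : 0 < (1 + eps) * ln n%:R by rewrite mulr_gt0 //; lra.
have [jJ|Jj] := ltnP j J.
  have [x [y [h1 [h2 [h3 h4]]]]] := HG _ jJ; exists x, y; do 2 split=> //.
  apply: scaleD_intro => //; first by rewrite ler0n ler_nat.
  apply: (le_trans h4); apply: (le_trans nG).
  by rewrite ler_peMl; lra.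
case: (walk b j) (early j Jj) (walk_le b j) (S_walk j) => // z zz zj ->.
have {}zz : (z1 <= z)%N by lia.
move: zz; rewrite !geq_max -andbA => /and3P[z0z m1z z2].
have far k : (K * z <= k)%N -> z%:Z + 2 <= walk b k.
  move=> Kk; have m1k : (m1 <= k)%N by apply: leq_trans Kk; nia.
  apply: (double_le_int z2 cK) (M1 k m1k).
  by rewrite ler_pM2l // -natrM ler_nat.
have [h1 h2] := @local_times z (K * z) (fun k kL => far k (ltnW kL)).
exists (visits z (mkseq b (K * z))), (nvisits z (mkseq b (K * z))); do 2 split=> //.
have ab := visits_le_nvisits_walk (far _ (leqnn (K * z))).
apply: scaleD_intro => //; first by rewrite ler0n ler_nat.
have := typ z z0z; rewrite far // andbT -leNgt => /le_trans; apply.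
rewrite ler_pM2l; last by lra.
by apply: ln_le_of_leq; lia.
Qed.

(** A block that hits realizes the pair at its site [z]; [before] and [after] keep the rest of the
    path off [z] and its neighbours. *)
Lemma realized_pairs (eps Cl : R) (D n1 : nat) : 0 < eps <= 1 -> 0 < grate p q ->
  (forall x y : R, 0 <= x <= y -> grate p q * y <= g p q x y) ->
  2 * C + 1 <= Cl ->
  (forall n, (n1 <= n)%N -> ~~ miss_upto p q eps Cl D n
     (mkseq b (n %/ (D * level Cl n) * (D * level Cl n)))) ->
  exists n0 : nat, forall n, (n0 <= n)%N -> forall k l : int,
    scaleD p q ((1 - eps) * ln n%:R) (k%:~R, l%:~R) ->
    exists2 j : nat, (j <= n)%N & exists a' b' : nat,
      xi_is X (S X j w) w a' /\ Xi_is X (S X j w) w b' /\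
      a'%:Z = k + 1 /\ b'%:Z = l + 2.
Proof.
case/andP=> eps0 eps1 gr0 g_lower ClC hits.
have [n2 far] := drawdown_far c_gt0 C_gt0 fast.
have [n3 N3] := ln_nat_large (m0%:R + 2 : R).
exists (maxn n1 (maxn n2 n3)) => n; rewrite !geq_max => /and3P[nn1 /far{}far /N3 lnn] k l kl.
have m00 : 0 <= m0%:R :> R by [].
have x0 : 0 <= ln n%:R :> R by exact: ln_nat_ge0.
have e1 : 0 <= 1 - eps by lra.
have [] := scaleDP (mulr_ge0 e1 x0) kl.
case: k l kl => [k|k] [l|l] kl; last 3 first.
- by case/andP=> _ h; move: h; rewrite ler_int.
- by case/andP=> h; move: h; rewrite ler0z.
- by case/andP=> h; move: h; rewrite ler0z.
rewrite -!pmulrn => /andP[k0 kl'] gx.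
have {k0}kln : (k <= l)%N by rewrite ler_nat in kl'.
have lB : (l < max_Xi p q n)%N.
  rewrite ltnS truncn_ge_nat; last by rewrite divr_ge0 // ltW.
  rewrite ler_pdivlMr // mulrC; have := g_lower k%:R l%:R; rewrite ler0n kl' => /(_ isT) h.
  by apply: (le_trans h); apply: (le_trans gx); rewrite ler_piMl // gerBl ltW.
have := hits n nn1; rewrite /miss_upto /miss.
set H := level Cl n; set M := (D * H)%N; set N := (n %/ M)%N => /hasPn /(_ (k, l)).
rewrite allpairs_f ?mem_iota ?add0n ?(leq_ltn_trans kln lB) //=.
move=> /(_ isT); rewrite kln gx /= => /allPn[i]; rewrite mem_iota add0n /= => iN.
rewrite negbK.
have iM : (i * M + M <= N * M)%N by rewrite addnC -mulSn leq_mul2r iN orbT.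
have NMn : (N * M <= n)%N by exact: leq_trunc_div.
set je := (i * M + M)%N in iM.
have iMje : (i * M <= je)%N by exact: leq_addr.
have tE : take M (drop (i * M) (mkseq b (N * M))) = drop (i * M) (mkseq b je).
  by rewrite take_drop addnC take_mkseq.
rewrite tE => /and3P[/eqP hv /eqP hn].
rewrite pos_drop_mkseq // => hpos.
set z := walk b (i * M) + H%:Z.
have HL : Cl * ln n%:R <= H%:R :> R.
  by apply: ltW; rewrite /H /level; exact: truncnS_gt.
have ClL : (2 * C + 1) * ln n%:R <= Cl * ln n%:R by rewrite ler_wpM2r.
have jn : (je <= n)%N := leq_trans iM NMn.
have HL' : (2 * C + 1) * ln n%:R <= H%:R := le_trans ClL HL.
have before u : (u <= i * M)%N -> walk b u + 2 <= z.
  move=> ui; have un : (i * M <= n)%N := leq_trans iMje jn.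
  rewrite -(ler_int R) /z !intrD -[(H%:Z)%:~R]pmulrn.
  apply: below_before (drawdown c_gt0 C_gt0 fast ui) _ _ HL' lnn.
    by rewrite ler_pM2l // ln_le_of_leq.
  by rewrite mulr_ge0 // ltW.
have after u : (je < u)%N -> z + 2 <= walk b u.
  move=> ju; have := far je u jn (ltnW ju).
  have : (H%:Z + H%:Z)%:~R <= (walk b je - walk b (i * M))%:~R :> R.
    by rewrite ler_int ltW.
  rewrite -(ler_int R) /z !intrD rmorphN -[(H%:Z)%:~R]pmulrn => h1 h2.
  exact: above_after h2 h1 HL' lnn.
have jeE : mkseq b je = mkseq b (i * M) ++ drop (i * M) (mkseq b je).
  by rewrite -{1}(cat_take_drop (i * M) (mkseq b je)) take_mkseq.
have zE : z - walk b (i * M) = H%:Z by rewrite /z addrC addKr.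
have [v0 vm vp] : [/\ visits z (mkseq b (i * M)) = 0%N,
    visits (z - 1) (mkseq b (i * M)) = 0%N & visits (z + 1) (mkseq b (i * M)) = 0%N].
  by split; apply: visits_eq0 => u /before/neq_near_of_gap[].
have vE : visits z (mkseq b je) = k.+1.
  by rewrite jeE visits_cat -/(walk b _) zE hv v0.
have nE : nvisits z (mkseq b je) = l.+2.
  by rewrite jeE nvisits_cat -/(walk b _) zE hn /nvisits vm vp.
have [j jje jz] : exists2 j, (j <= je)%N & walk b j = z by apply: visits_gt0; rewrite vE.
have [h1 h2] := @local_times z je after.
exists j; first exact: leq_trans jje jn.
exists k.+1, l.+2; rewrite S_walk jz -{1}vE -{1}nE; do 2 split=> //.
by rewrite -addn1 -addn2 !PoszD.
Qed.
End Trajectory.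

(** * Combination of the almost sure events *)

Theorem theorem3p4 (d : measure_display) (T : measurableType d) (R : realType)
  (P : probability T R) (X : nat -> T -> R) (p q : R)
  (hq : 0 < q) (hqp : q < p) (hp : p < 1) (hpq : p + q = 1)
  (hXmeas : forall i, measurable_fun setT (X i))
  (hXind : mutually_independent P X)
  (hX1 : forall i, P [set w | X i w = 1] = p%:E)
  (hXm1 : forall i, P [set w | X i w = -1] = q%:E)
  (eps : R) (heps : 0 < eps) (heps1 : eps <= 1) :
  {ae P, forall w, exists n0 : nat, forall n : nat, (n0 <= n)%N ->
     (forall j : nat, (1 <= j <= n)%N ->
        exists a b : nat,
          xi_is X (S X j w) w a /\ Xi_is X (S X j w) w b /\
          scaleD p q ((1 + eps) * ln n%:R) (a%:R, b%:R))
     /\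
     (forall k l : int,
        scaleD p q ((1 - eps) * ln n%:R) (k%:~R, l%:~R) ->
        exists2 j : nat, (j <= n)%N &
          exists a b : nat,
            xi_is X (S X j w) w a /\ Xi_is X (S X j w) w b /\
            a%:Z = k + 1 /\ b%:Z = l + 2)}.
Proof.
have hp0 : 0 < p := lt_trans hq hqp.
have eps01 : 0 < eps <= 1 by rewrite heps.
have BC A L B e n0 := @ae_eventually_not _ _ _ P X p q hpq hXmeas hXind hX1 hXm1 A L B e n0.
have [c c0 [C C0 slow]] := Ex_slow_suffix hp0 hq hpq hqp.
have [Ca Ca0 atyp] := Ex_atypical_le hp0 hq hpq hqp heps.
have [Cl [ClC _] [D _ [n1 missP]]] := Ex_miss_le hp0 hq hpq hqp (2 * C + 1) eps01.
(* At speed [c], [K * z] steps carry the walk beyond [2 z]. *)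
pose K := (Num.truncn (2 / c)).+1.
have cK : 2 <= c * K%:R.
  rewrite mulrC -ler_pdivrMr //; apply: ltW; exact: truncnS_gt.
have e2 : 0 < eps / 2 by rewrite divr_gt0.
have A1 := BC _ id 1 1 1%N ltr01 ltr01
  (fun m m1 => le_trans (slow m m1) (ler_peMl (expR_ge0 _) (lexx 1))).
have A2 := BC _ (fun z => K * z)%N Ca (eps / 2) 2%N Ca0 e2 (fun z z2 => atyp z _ z2).
have A3 := BC _ (fun n => n %/ (D * level Cl n) * (D * level Cl n))%N 1 1 n1 ltr01 ltr01
  (fun n nn => le_trans (missP n nn) (ler_peMl (expR_ge0 _) (lexx 1))).
have A0 := ae_sign hpq hXmeas hX1 hXm1.
(* On the intersection of the four events the argument is pathwise. *)
apply: filterS (filterI (filterI A1 A2) (filterI A3 A0)) => w [[[m0 h1] [z0 h2]] [[n3 h3] Xs]].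
have fast m j : (m0 <= m)%N -> (j < m)%N -> C * ln m%:R <= (m - j)%:R ->
    c * (m - j)%:R < (walk (bits X w) m - walk (bits X w) j)%:~R.
  move=> mm jm hC; have /hasPn/(_ j) := h1 m mm.
  rewrite mem_iota add0n jm => /(_ isT); rewrite hC /= -ltNge.
  by rewrite pos_drop_mkseq // ltnW.
have [N1 H1] := typical_sites Xs c0 C0 fast heps cK h2.
have [N2 H2] := realized_pairs Xs c0 C0 fast eps01 (grate_gt0 hp0 hq hpq hqp)
  (g_ge hp0 hq hpq hqp) ClC h3.
exists (maxn N1 N2) => n; rewrite geq_max => /andP[nN1 nN2]; split.
  by move=> j /andP[_ jn]; exact: H1.
exact: H2.
Qed.
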